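(* Let $x\in\mathbb{C}^n-\Delta$. For an independent ordered subset $I=\{i_1,\dots,i_k\}\subset J$ we have $$\pi(F_I)=\sum_{\mathcal{C}_{J_\lambda}(x)\in E_I}\frac{1}{a(J_\lambda,J)}\,s(\mathcal{C}_{J_\lambda}(x))\ \in\ \mathrm{Sing}_aV,$$ where $E_I$ is the set of all elementary subarrangements $\mathcal{C}_{J_\lambda}(x)$ of $\mathcal{C}(x)$ (of all types) which have $F_I$ as a distinguished element, and $s(\mathcal{C}_{J_\lambda}(x))$ is the singular element with sign normalized by $F_I$ (as specified in the context).
   Context: **Family of arrangements.** Let $k<n$ be positive integers, $J=\{1,\dots,n\}$. Fix nonzero linear functions $g_j=b_j^1t_1+\dots+b_j^kt_k$, $j\in J$, on $\mathbb{C}^k$, spanning $(\mathbb{C}^k)^*$. For $x\in\mathbb{C}^n$ let $\mathcal{C}(x)$ be the arrangement in $\mathbb{C}^k$ of the hyperplanes $H_j(x)=\{g_j+x_j=0\}$, $j\in J$. It is with normal crossings if exactly $k$ hyperplanes meet at every vertex (a point that is an intersection of hyperplanes). $\Delta\subset\mathbb{C}^n$ is the set of $x$ for which $\mathcal{C}(x)$ is not with normal crossings. A subset $I\subset J$ is independent if $\{g_i\}_{i\in I}$ are linearly independent. **Weights.** Fix $a=(a_1,\dots,a_n)\in(\mathbb{C}^\times)^n$; $a_J=\sum_{j\in J}a_j$. In $\mathbb{P}^k\supset\mathbb{C}^k$ the hyperplane at infinity $H_\infty$ gets weight $-a_J$. An edge is a nonempty intersection of hyperplanes; its weight is the sum of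 weights of all hyperplanes containing it; it is dense if the subarrangement of hyperplanes containing it is irreducible (cannot be partitioned into nonempty sets so that, after a change of coordinates, hyperplanes in different sets are in different coordinates). $(\mathcal{C}(x),a)$ is unbalanced if every dense edge of $(H_j(x))_{j\in J}\cup\{H_\infty\}$ has nonzero weight. It is assumed that $(\mathcal{C}(x),a)$ is unbalanced for all $x\in\mathbb{C}^n-\Delta$. **Flag space.** $V=\mathcal{F}^k(\mathcal{C}(x))$, $x\in\mathbb{C}^n-\Delta$, is the complex vector space with basis $F_{j_1,\dots,j_k}$, $\{j_1<\dots<j_k\}\subset J$ independent; $F_{j_1,\dots,j_k}$ is skew-symmetric in its indices, and is $0$ for dependent index sets. For any independent ordered subset one has $F_{j_1,\dots,j_p}\in\mathcal{F}^p(\mathcal{C}(x))$ similarly, and products are $F_{i_1,\dots,i_p}\wedge F_{j_1,\dots,j_q}=F_{i_1,\dots,i_p,j_1,\dots,j_q}$. The contravariant form $S^{(a)}$ on $V$ is the symmetric bilinear form for which the basis is orthogonal and $S^{(a)}(F_{j_1,\dots,j_k},F_{j_1,\dots,j_k})=a_{j_1}\cdots a_{j_k}$. $\mathrm{Sing}_aV\subset V$ consists of the vectors orthogonal to all $\sum_{j\in J}F_{j,i_1,\dots,i_{k-1}}$ with $\{i_1,\dots,i_{k-1}\}\subset J$ independent. $\pi:V\to\mathrm{Sing}_aV$ is the orthogonal projection with respect to $S^{(a)}$. **Elementary subarrangements.** Let $\lambda=(\lambda_1,\dots,\lambda_m)$ be positive integers with sum $k$; $\lambda^h=\lambda_1+\dots+\lambda_h$.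 An elementary subarrangement of type $\lambda$, $\mathcal{C}_{J_\lambda}(x)=(H_i(x))_{i\in J_\lambda}$, is given by an ordered tuple $(J_1,\dots,J_m)$ of pairwise disjoint subsets of $J$, $|J_h|=\lambda_h+1$, $J_\lambda=\cup_hJ_h$, such that, with $X_h^*=\mathrm{span}\{g_i\}_{i\in J_1\cup\dots\cup J_h}$, for every $h$: (i) $\dim X_h^*=\lambda^h$; (ii) for every $j\in J_h$, $\dim\mathrm{span}\{g_l : l\in(J_1\cup\dots\cup J_h)-\{j\}\}=\lambda^h$. The ordered tuple is part of the data (different tuples count as different elementary subarrangements, the order inside each $J_h$ being irrelevant). Its weight is $a(J_\lambda,J)=a_J\prod_{h=1}^{m-1}a(J_\lambda,J,h)$, $a(J_\lambda,J,h)=\sum_{i\in J,\ g_i\notin X_h^*}a_i$. **Distinguished and singular elements.** The distinguished elements of $\mathcal{C}_{J_\lambda}(x)$ are the elements $F_{K_1}\wedge\dots\wedge F_{K_m}$ up to sign, where $K_h$ is an ordered $\lambda_h$-element subset of $J_h$. With $J_h=\{j_1^h,\dots,j_{\lambda_h+1}^h\}$ and $K_{\widehat{j_i^h}}=(j_1^h,\dots,\widehat{j_i^h},\dots,j_{\lambda_h+1}^h)$, the singular element is $$s(\mathcal{C}_{J_\lambda}(x))=\Bigl(\sum_{i=1}^{\lambda_1+1}(-1)^{i+1}a_{j_i^1}F_{K_{\widehat{j_i^1}}}\Bigr)\wedge\dots\wedge\Bigl(\sum_{i=1}^{\lambda_m+1}(-1)^{i+1}a_{j_i^m}F_{K_{\widehat{j_i^m}}}\Bigr)\in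 V,$$ defined up to multiplication by $\pm1$ (depending on the orderings of the $J_h$). For $\mathcal{C}_{J_\lambda}(x)\in E_I$ the sign is fixed so that $F_I$ enters $s(\mathcal{C}_{J_\lambda}(x))$ with coefficient $+\prod_{h=1}^m a_{j^h}$, where $j^h$ is the unique element of $J_h$ not in $I$. *)

(* Defs.v *)
From HB Require Import structures.
From mathcomp Require Import all_boot all_order all_algebra.
From mathcomp Require Export reals.
From mathcomp.real_closed Require Export complex.

Set Implicit Arguments.
Unset Strict Implicit.
Unset Printing Implicit Defensive.

Import GRing.Theory.
Local Open Scope ring_scope.

Section Arrangement.
Variables (F : fieldType) (n k : nat).
(* Row j of b holds the coefficients of the linear function g_j. *)
Variable b : 'M[F]_(n, k).

Definition gspan (A : {set 'I_n}) : {vspace 'rV[F]_k} :=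
  <<[seq row i b | i <- enum A]>>%VS.

Definition indep (s : seq 'I_n) : bool := free [seq row i b | i <- s].

Definition indep_sets (p : nat) : {set {set 'I_n}} :=
  [set A : {set 'I_n} | indep (enum A) && (#|A| == p)].

Section Position.
Variable x : 'I_n -> F.

Definition on_hyperplane (j : 'I_n) (t : 'cV[F]_k) : bool :=
  (b *m t) j 0 + x j == 0.

Definition vertex (v : 'cV[F]_k) : Prop :=
  exists A : {set 'I_n},
    forall t : 'cV[F]_k, (forall j, j \in A -> on_hyperplane j t) <-> t = v.

(* Hyperplanes are counted by their index: two coinciding hyperplanes
   H_i(x) = H_j(x) with i != j violate normal crossings. *)
Definition normal_crossings : Prop :=
  forall v, vertex v -> #|[set j | on_hyperplane j v]| = k.

(* In homogeneous coordinates (t_0 : t_1 : ... : t_k) on P^k the index None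
   stands for the hyperplane at infinity t_0 = 0, and Some j for the closure
   x_j t_0 + g_j(t) = 0 of H_j(x). *)
Definition hform (o : option 'I_n) : 'rV[F]_(1 + k) :=
  if o is Some j then row_mx (x j)%:M (row j b) else row_mx 1%:M 0.

Definition hhyperplane (o : option 'I_n) : {vspace 'cV[F]_(1 + k)} :=
  lker (linfun (mulmx (hform o))).

(* The linear cone in F^(1 + k) over a subspace of P^k; the latter is nonempty
   if and only if the cone is not 0. *)
Definition cone (A : {set option 'I_n}) : {vspace 'cV[F]_(1 + k)} :=
  (\bigcap_(o in A) hhyperplane o)%VS.

Definition containing (E : {vspace 'cV[F]_(1 + k)}) : {set option 'I_n} :=
  [set o | (E <= hhyperplane o)%VS].

(* After the coordinate change M, hyperplanes in different blocks of the
   partition P involve disjoint sets of coordinates. *)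
Definition reducible (B : {set option 'I_n}) : Prop :=
  exists P : {set {set option 'I_n}}, [/\ partition P B, (1 < #|P|)%N &
    exists2 M : 'M[F]_(1 + k), M \in unitmx &
      forall B1 B2, B1 \in P -> B2 \in P -> B1 != B2 ->
      forall o1 o2, o1 \in B1 -> o2 \in B2 ->
      forall c, (hform o1 *m M) 0 c = 0 \/ (hform o2 *m M) 0 c = 0].

Definition hweight (a : 'I_n -> F) (o : option 'I_n) : F :=
  if o is Some j then a j else - \sum_j a j.

Definition unbalanced (a : 'I_n -> F) : Prop :=
  forall A : {set option 'I_n}, A != set0 -> cone A != 0%VS ->
    ~ reducible (containing (cone A)) ->
    \sum_(o in containing (cone A)) hweight a o != 0.

End Position.

(* Ambient space of all flag spaces F^p at once: the coordinate at A is the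
   one along F_{j_1,...,j_p}, where A = {j_1 < ... < j_p}. Coordinates at
   dependent sets A are never used. *)
Definition flags := {ffun {set 'I_n} -> F^o}.

Fixpoint inversions (s : seq 'I_n) : nat :=
  if s is i :: s' then (count (fun j : 'I_n => (j < i)%N) s' + inversions s')%N
  else 0%N.

Definition flag (s : seq 'I_n) : flags :=
  if indep s then [ffun A => (-1) ^+ inversions s *+ (A == [set i in s])] else 0.

(* The coefficient of F_s in v, for s independent. *)
Definition flag_coef (s : seq 'I_n) (v : flags) : F :=
  (-1) ^+ inversions s * v [set i in s].

Definition wedge (u v : flags) : flags :=
  \sum_(A : {set 'I_n}) \sum_(B : {set 'I_n})
     (u A * v B) *: flag (enum A ++ enum B).

Definition wedges (us : seq flags) : flags := foldr wedge (flag [::]) us.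

Definition Vflag : {vspace flags} :=
  <<[seq flag (enum A) | A : {set 'I_n} in indep_sets k]>>%VS.

Definition flag_extensions (s : seq 'I_n) : flags := \sum_(j < n) flag (j :: s).

Section Weights.
Variable a : 'I_n -> F.

Definition cform (u v : flags) : F :=
  \sum_(A in indep_sets k) (\prod_(i in A) a i) * (u A * v A).

Lemma cformC u v : cform u v = cform v u.
Proof. by apply: eq_bigr => A _; rewrite (mulrC (u A)). Qed.

Lemma cform_linearr u : linear_for *%R (cform u).
Proof.
move=> c v w; rewrite /cform mulr_sumr -big_split; apply: eq_bigr => A _ /=.
by rewrite !ffunE !mulrDr /=; congr (_ + _); rewrite (mulrCA c) (mulrCA c).
Qed.

Lemma cform_linearl u : linear_for *%R (cform ^~ u).
Proof. by move=> c v w; rewrite !(cformC _ u) cform_linearr. Qed.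

HB.instance Definition _ :=
  bilinear_isBilinear.Build F flags flags F *%R *%R cform
    (cform_linearl, cform_linearr).

Lemma cform_sym u v : cform u v = (-1) ^+ false * idfun (cform v u).
Proof. by rewrite expr0 mul1r cformC. Qed.

HB.instance Definition _ :=
  isHermitianSesquilinear.Build F flags false idfun cform cform_sym.

Definition Sing : {vspace flags} :=
  (Vflag :&: orthov (cform : {symmetric flags})
     <<[seq flag_extensions (enum A) | A : {set 'I_n} in indep_sets k.-1]>>)%VS.

Definition Sing_perp : {vspace flags} := (Vflag :&: orthov (cform : {symmetric flags}) Sing)%VS.

(* The projection along Sing_perp. It is the orthogonal projection of V onto
   Sing only when V is the direct sum of Sing and Sing_perp. *)
Definition Sing_proj : 'End(flags) := daddv_pi Sing Sing_perp.

(* With h counted from 1, X_h^* = gspan (Jcup Js h). *)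
Definition Jcup (Js : seq {set 'I_n}) (h : nat) : {set 'I_n} :=
  \bigcup_(A <- take h Js) A.

(* Here h is counted from 0, so that \lambda^(h+1) = sumn (take h.+1 lam). *)
Definition elementary (lam : seq nat) (Js : seq {set 'I_n}) : bool :=
  [&& all (fun l => (0 < l)%N) lam, sumn lam == k, size Js == size lam,
      pairwise (fun A B : {set 'I_n} => [disjoint A & B]) Js &
      [forall h : 'I_(size lam),
        [&& #|nth set0 Js h| == (nth 0%N lam h).+1,
            \dim (gspan (Jcup Js h.+1)) == sumn (take h.+1 lam) &
            [forall j in nth set0 Js h,
              \dim (gspan (Jcup Js h.+1 :\ j)) == sumn (take h.+1 lam)]]]].

(* The only possible type of Js. *)
Definition etype (Js : seq {set 'I_n}) : seq nat := [seq #|A|.-1 | A : {set 'I_n} <- Js].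

Definition eweight (Js : seq {set 'I_n}) : F :=
  (\sum_(i < n) a i) *
  \prod_(1 <= h < size Js) \sum_(i < n | row i b \notin gspan (Jcup Js h)) a i.

(* Reordering K_h only changes the sign, so K_h ranges over sets. *)
Definition distinguished (Js : seq {set 'I_n}) (v : flags) : bool :=
  [exists Ks : (size Js).-tuple {set 'I_n},
    all2 (fun K J : {set 'I_n} => (K \subset J) && (#|K| == #|J|.-1)) Ks Js &&
    (let w := wedges [seq flag (enum K) | K : {set 'I_n} <- Ks] in
     (v == w) || (v == - w))].

(* The sizes |J_h| - 1 are positive with sum k, hence there are at most k sets
   J_h. *)
Definition elementary_through (I : seq 'I_n) : {set k.-bseq {set 'I_n}} :=
  [set Js : k.-bseq {set 'I_n} |
    elementary (etype Js) Js && distinguished Js (flag I)].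

Definition singular_factor (s : seq 'I_n) : flags :=
  \sum_(j <- s) ((-1) ^+ index j s * a j) *: flag (rem j s).

(* The singular element for the given orderings of the J_h. *)
Definition singular_element (Ss : seq (seq 'I_n)) : flags :=
  wedges [seq singular_factor s | s <- Ss].

(* The sign is the one for which F_I has coefficient + prod_h a_{j^h}; for Js
   in elementary_through I, each A :\: I is the singleton {j^h}. *)
Definition singular_element_at (I : seq 'I_n) (Js : seq {set 'I_n}) : flags :=
  let s := singular_element [seq enum A | A : {set 'I_n} <- Js] in
  if flag_coef I s == \prod_(A <- Js) \prod_(j in A :\: [set i in I]) a j
  then s else - s.

End Weights.
End Arrangement.

(* Main.v *)
From HB Require Import structures.
Require Import Defs.
From mathcomp Require Import all_boot all_order all_algebra.
From mathcomp Require Import zify ring.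

Set Implicit Arguments.
Unset Strict Implicit.
Unset Printing Implicit Defensive.

Import GRing.Theory.
Local Open Scope ring_scope.
Local Open Scope complex_scope.

(** Why the theorem holds.  Let I be a basis.  For j outside I, let D_j be the
    set of those p in I at which g_j has a nonzero coordinate in the basis
    (g_p), p in I.  An elementary subarrangement with F_I as a distinguished
    element is the same thing as a chain: starting from X = set0, choose j
    outside I whose D_j is not contained in X, put J_h = {j} together with
    D_j minus X, replace X by its union with D_j, and stop when X = I
    ([elementary_throughP]).  Since X_h^* is the span of the set X reached
    after h blocks, the weight of the subarrangement is the product over the
    sets X met along the chain of
    a(X) = the sum of all a_j with D_j not contained in X ([eweight_chain]).

    Each singular element lies in Sing V ([singular_element_Sing]).  After
    rescaling F_A by the product of a_i, i in A, it becomes, up to a scalar,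
    a product of boundaries of simplices.  All the flags obtained by dropping
    one index from each J_h are nonzero, so the boundary is a derivation on
    these products, and its square vanishes.  The boundary is adjoint to the
    map F_A -> sum_j F_{j,A}, which gives the orthogonality.

    It remains to see that F_I and the sum s have the same pairing with every
    v in Sing V ([projection_expansion]).  Replace I by a basis P ++ Q, where P
    has the span of X and Q is the list of elements of I outside X, and sum over
    the chains that start at X.  Induct along the chain: the sum over the tail
    of a chain is known by induction, for every choice of the flag kept from the
    first block, so only the sum over the first index j is left.  There, the
    relations sum_j <F_{P,j,Q minus p}, v> = 0 collapse everything to
    a(X) <F_{P,Q}, v> ([step_sum]), and a(X) is the weight to divide by.

    This a(X) is nonzero because, up to sign, it is the weight of the edge at
    infinity where all g_j with D_j contained in X vanish.  That edge is dense
    for generic x: each circuit {j} + D_j of the linear forms becomes, in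
    homogeneous coordinates, a circuit through the hyperplane at infinity, and X is a
    union of such D_j ([flat_irreducible]).

    Finally, s lies in Sing V and F_I - s is orthogonal to it.  As this holds for
    every basis I, V is the sum of Sing V and its orthogonal complement; the form
    is nondegenerate on V, so the sum is direct and s is the projection. *)

(** * Signs of sequences of indices *)

Lemma eq_signr (K : pzRingType) p q : odd p = odd q -> (-1) ^+ p = (-1) ^+ q :> K.
Proof. by move=> e; rewrite -signr_odd e signr_odd. Qed.

Section Inversions.
Variable n : nat.
Implicit Types (s t : seq 'I_n) (A B : {set 'I_n}).

(** The inversions of [s ++ t] that involve both lists depend on [s] and [t] only up to
    permutation, so that signs of products can be compared by counting. *)
Definition crossings s t := (\sum_(i <- s) count (fun j : 'I_n => j < i) t)%N.

Lemma inversions_cat s t :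
  inversions (s ++ t) = (inversions s + inversions t + crossings s t)%N.
Proof.
rewrite /crossings; elim: s => [|i s IH] /=; first by rewrite big_nil addn0.
by rewrite IH big_cons count_cat; lia.
Qed.

Lemma perm_crossings s s' t t' :
  perm_eq s s' -> perm_eq t t' -> crossings s t = crossings s' t'.
Proof.
move=> ps /permP pt; rewrite /crossings (perm_big _ ps).
by apply: eq_bigr => i _; rewrite pt.
Qed.

(** Moving an entry to the front crosses the [index j s] entries before it. *)
Lemma odd_index_inversions j s : uniq s -> j \in s ->
  odd (index j s + inversions s) = odd (inversions (j :: rem j s)).
Proof.
elim: s => //= i s IH /andP[nis us]; rewrite inE; rewrite [j == i]eq_sym.
case: (eqVneq i j) => [->//|nij] /= js.
rewrite addnCA oddD /= IH //= (permP (perm_to_rem js)) /= !oddD.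
have nv : nat_of_ord i != j by [].
by case: (ltngtP i j) nv => //= _ _; do 3!case: (odd _).
Qed.

Lemma inversions_enum A : inversions (enum A) = 0%N.
Proof.
have: pairwise (fun i j : 'I_n => i < j)%N (enum A).
  have: pairwise ltn (map val (enum A)).
    rewrite -(sorted_pairwise ltn_trans) (subseq_sorted ltn_trans (s2 := iota 0 n)) //.
      by rewrite -val_enum_ord map_subseq // enumT filter_subseq.
    exact: iota_ltn_sorted.
  by rewrite pairwise_map.
elim: (enum A) => //= i s IH /andP[/allP ale ps]; rewrite IH // addn0.
apply/eqP; rewrite -leqn0 leqNgt -has_count; apply/hasPn => j js.
by rewrite -leqNgt ltnW // ale.
Qed.

Lemma perm_enum_set s : uniq s -> perm_eq (enum [set i in s]) s.
Proof.
by move=> us; apply: uniq_perm (enum_uniq _) us _ => i; rewrite mem_enum inE.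
Qed.

Lemma perm_enum_setD1 p A : p \in A -> perm_eq (enum A) (p :: enum (A :\ p)).
Proof.
move=> pA; apply: uniq_perm; rewrite /= ?mem_enum ?setD11 ?enum_uniq // => i.
by rewrite inE !mem_enum !inE; case: eqP => [->|].
Qed.

Lemma perm_middle s j t : perm_eq (s ++ j :: t) (j :: s ++ t).
Proof. exact: permEl (perm_catCA s [:: j] t). Qed.

Lemma rem_cat j s t : rem j (s ++ t) = if j \in s then rem j s ++ t else s ++ rem j t.
Proof.
elim: s => //= i s IH; rewrite inE [j == i]eq_sym; case: (eqVneq i j) => //= _.
by rewrite IH; case: ifP.
Qed.

End Inversions.

(** * Flags and their products *)

Section Flags.
Variables (K : fieldType) (n k : nat) (b : 'M[K]_(n, k)).
Implicit Types (s t : seq 'I_n) (A B C : {set 'I_n}) (u v : flags K n).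

(** The coordinate vectors, also at dependent sets [A], where they are not flags. *)
Definition unit_flag A : flags K n := [ffun B => (B == A)%:R].

Lemma flags_sum u : u = \sum_A u A *: unit_flag A.
Proof.
apply/ffunP => B; rewrite sum_ffunE (bigD1 B) //= !ffunE eqxx [_ *: _]mulr1 big1 ?addr0 //.
by move=> A nAB; rewrite !ffunE eq_sym (negbTE nAB) [_ *: _]mulr0.
Qed.

Lemma perm_indep s t : perm_eq s t -> indep b s = indep b t.
Proof. by move=> p; apply: perm_free; apply: perm_map. Qed.

Lemma indep_uniq s : indep b s -> uniq s.
Proof. by move=> /free_uniq /map_uniq. Qed.

Lemma indep_catl s t : indep b (s ++ t) -> indep b s.
Proof. by rewrite /indep map_cat; apply: catl_free. Qed.

Lemma indep_catr s t : indep b (s ++ t) -> indep b t.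
Proof. by rewrite /indep map_cat; apply: catr_free. Qed.

Lemma indep_enum s : uniq s -> indep b (enum [set i in s]) = indep b s.
Proof. by move=> us; apply/perm_indep/perm_enum_set. Qed.

Lemma indep_rem j s : indep b s -> indep b (rem j s).
Proof.
case: (boolP (j \in s)) => [js|/rem_id->//].
by rewrite (perm_indep (perm_to_rem js)) -cat1s => /indep_catr.
Qed.

Lemma flagE s : indep b s -> flag b s = (-1) ^+ inversions s *: unit_flag [set i in s].
Proof.
move=> is_; rewrite /flag is_; apply/ffunP => A; rewrite !ffunE.
by case: eqP => _; rewrite ?mulr0n ?mulr1n; [rewrite [RHS]mulr1 | rewrite [RHS]mulr0].
Qed.

Lemma flag_dep s : ~~ indep b s -> flag b s = 0.
Proof. by rewrite /flag => /negbTE->. Qed.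

Lemma set_enum A : [set i in enum A] = A.
Proof. by apply/setP => i; rewrite inE mem_enum. Qed.

Lemma flag_enum A : indep b (enum A) -> flag b (enum A) = unit_flag A.
Proof. by move=> iA; rewrite flagE // inversions_enum scale1r set_enum. Qed.

Lemma eq_set_perm s t : perm_eq s t -> [set i in s] = [set i in t].
Proof. by move=> /perm_mem e; apply/setP => i; rewrite !inE e. Qed.

(** Both flags are signs times the same coordinate vector, so the sign relating
    them can be read off from the two inversion numbers. *)
Lemma perm_flag s t : perm_eq s t ->
  flag b s = (-1) ^+ (inversions s + inversions t) *: flag b t.
Proof.
move=> pst; case: (boolP (indep b t)) => it; last first.
  by rewrite !flag_dep ?scaler0 // (perm_indep pst).
rewrite !flagE // ?(perm_indep pst) // scalerA -exprD (eq_set_perm pst).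
by congr (_ *: _); apply: eq_signr; rewrite !oddD -addbA addbb addbF.
Qed.

Lemma flag_middle s j t : flag b (s ++ j :: t) = (-1) ^+ size s *: flag b (j :: s ++ t).
Proof.
case: (boolP (indep b (s ++ j :: t))) => ist; last first.
  by rewrite !flag_dep ?scaler0 // -(perm_indep (perm_middle s j t)).
have us := indep_uniq ist.
have jst : j \in s ++ j :: t by rewrite mem_cat mem_head orbT.
have njs : j \notin s.
  by move: us; rewrite (perm_uniq (perm_middle s j t)) /= mem_cat => /andP[/norP[]].
rewrite (perm_flag (perm_middle s j t)); congr (_ *: _); apply: eq_signr.
have := odd_index_inversions us jst.
rewrite index_cat rem_cat (negbTE njs) /= !eqxx addn0 oddD => e.
by rewrite oddD -e addbC -addbA addbb addbF.
Qed.

Lemma flag_cons_rem j s : uniq s -> j \in s ->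
  (-1) ^+ index j s *: flag b (j :: rem j s) = flag b s.
Proof.
move=> us js; rewrite [RHS](perm_flag (perm_to_rem js)); congr (_ *: _); apply: eq_signr.
by rewrite oddD -odd_index_inversions // oddD addbC -addbA addbb addbF.
Qed.

Lemma wedge_linearr u : linear (wedge b u).
Proof.
move=> c v w; rewrite /wedge scaler_sumr -big_split; apply: eq_bigr => A _ /=.
rewrite scaler_sumr -big_split; apply: eq_bigr => B _ /=.
by rewrite !ffunE mulrDr scalerDl scalerA; congr (_ *: _ + _); apply: mulrCA.
Qed.

Lemma wedge_linearl v : linear ((wedge b)^~ v).
Proof.
move=> c u w; rewrite /wedge scaler_sumr -big_split; apply: eq_bigr => A _ /=.
rewrite scaler_sumr -big_split; apply: eq_bigr => B _ /=.
by rewrite !ffunE mulrDl scalerDl scalerA; congr (_ *: _ + _); rewrite mulrA.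
Qed.

HB.instance Definition _ :=
  bilinear_isBilinear.Build K (flags K n) (flags K n) (flags K n) *:%R *:%R (wedge b)
    (wedge_linearl, wedge_linearr).

Lemma wedge_unit A B : wedge b (unit_flag A) (unit_flag B) = flag b (enum A ++ enum B).
Proof.
rewrite /wedge (bigD1 A) //= [X in _ + X]big1 ?addr0 => [|C nCA]; last first.
  by apply: big1 => D _; rewrite !ffunE (negbTE nCA) mul0r scale0r.
rewrite (bigD1 B) //= [X in _ + X]big1 ?addr0 => [|C nCB]; last first.
  by rewrite !ffunE (negbTE nCB) mulr0 scale0r.
by rewrite !ffunE !eqxx mulr1 scale1r.
Qed.

Lemma wedge_flag_unit s B : wedge b (flag b s) (unit_flag B) = flag b (s ++ enum B).
Proof.
case: (boolP (indep b s)) => is_; last first.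
  rewrite flag_dep // linear0l flag_dep //.
  by apply: contra is_ => /indep_catl.
have ps : perm_eq (enum [set i in s]) s by apply/perm_enum_set/(indep_uniq is_).
rewrite flagE // linearZl_LR /= wedge_unit.
rewrite (@perm_flag (enum _ ++ _) (s ++ enum B)) ?perm_cat2r // scalerA -exprD.
rewrite -[RHS]scale1r; congr (_ *: _); rewrite !inversions_cat !inversions_enum.
by rewrite (perm_crossings ps (perm_refl _)) -signr_odd !oddD /=; do 3?case: (odd _).
Qed.

Lemma wedge_flag s t : wedge b (flag b s) (flag b t) = flag b (s ++ t).
Proof.
case: (boolP (indep b t)) => it; last first.
  rewrite (flag_dep it) linear0r flag_dep //.
  by apply: contra it => /indep_catr.
have pt : perm_eq (enum [set i in t]) t by apply/perm_enum_set/(indep_uniq it).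
rewrite [flag b t]flagE // linearZr_LR /= wedge_flag_unit.
rewrite (@perm_flag (_ ++ enum _) (s ++ t)) ?perm_cat2l // scalerA -exprD.
rewrite -[RHS]scale1r; congr (_ *: _); rewrite !inversions_cat !inversions_enum.
by rewrite (perm_crossings (perm_refl _) pt) -signr_odd !oddD /=; do 3?case: (odd _).
Qed.

Lemma wedge_expandr v u : wedge b v u = \sum_B u B *: wedge b v (unit_flag B).
Proof.
by rewrite {1}(flags_sum u) linear_sumr; apply: eq_bigr => B _; rewrite linearZr_LR.
Qed.

Lemma wedge_expandl v u : wedge b u v = \sum_B u B *: wedge b (unit_flag B) v.
Proof.
by rewrite {1}(flags_sum u) linear_sumlz; apply: eq_bigr => B _; rewrite linearZl_LR.
Qed.

(** Products of lists are concatenations even when a flag vanishes, because a list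
    with a dependent part is dependent. *)
Lemma wedge_flagA s t u :
  wedge b (flag b s) (wedge b (flag b t) u) = wedge b (flag b (s ++ t)) u.
Proof.
rewrite (wedge_expandr (flag b t)) (wedge_expandr (flag b (s ++ t))) linear_sumr.
by apply: eq_bigr => B _; rewrite linearZr_LR /= !wedge_flag_unit wedge_flag catA.
Qed.

Lemma wedges_flag (I : Type) (r : seq I) (f : I -> seq 'I_n) :
  wedges b [seq flag b (f i) | i <- r] = flag b (flatten [seq f i | i <- r]).
Proof. by elim: r => //= i r ->; rewrite wedge_flag. Qed.

End Flags.

(** * Singular elements are singular vectors *)

(** The inductive form of an argument by linearity on a spanning list; it avoids
    packaging the statement to be proved as an equality of linear maps. *)
Lemma span_ind (K : fieldType) (V : vectType K) (X : seq V) (P : V -> Prop) :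
    P 0 -> (forall c x u, x \in X -> P u -> P (c *: x + u)) ->
  forall u, u \in <<X>>%VS -> P u.
Proof.
move=> P0 PD u uX; rewrite (@coord_span _ _ _ (in_tuple X) u uX).
elim/big_rec: _ => // i v _ Pv; apply: PD => //; exact: mem_nth.
Qed.

Section Singular.
Variables (K : fieldType) (n k : nat) (b : 'M[K]_(n, k)).
Implicit Types (s t : seq 'I_n) (A B C : {set 'I_n}) (u v : flags K n).
Implicit Types (a : 'I_n -> K) (Ss : seq (seq 'I_n)).

Local Notation sf := (singular_factor b).
Local Notation sf1 := (singular_factor b (fun=> 1)).

Lemma perm_rem j s t : perm_eq s t -> perm_eq (rem j s) (rem j t).
Proof.
move=> pst; case: (boolP (j \in s)) => js; last by rewrite !rem_id // -(perm_mem pst).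
have jt : j \in t by rewrite -(perm_mem pst).
by rewrite -(perm_cons j) -(permPl (perm_to_rem js)) -(permPr (perm_to_rem jt)).
Qed.

Lemma odd_index_rem j s t : uniq s -> perm_eq s t -> j \in s ->
  odd (index j s + inversions (rem j s) + inversions s) =
  odd (index j t + inversions (rem j t) + inversions t).
Proof.
have H r : uniq r -> j \in r -> odd (index j r + inversions (rem j r) + inversions r)
    = odd (count (fun i : 'I_n => (i < j)%N) (rem j r)).
  move=> ur jr; rewrite addnAC oddD odd_index_inversions // oddD /=.
  by rewrite -addbA addbb addbF.
move=> us pst js; have jt : j \in t by rewrite -(perm_mem pst).
rewrite !H -?(perm_uniq pst) //; congr (odd _); exact/permP/perm_rem.
Qed.

(** Removing [j] with the sign of its position is contraction by [j], which does
    not depend on how the other indices are listed. *)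
Lemma perm_signed_rem j s t : uniq s -> perm_eq s t -> j \in s ->
  (-1) ^+ (index j s + inversions s) *: flag b (rem j s) =
  (-1) ^+ (index j t + inversions t) *: flag b (rem j t).
Proof.
move=> us pst js; rewrite (perm_flag b (perm_rem j pst)) scalerA -exprD.
congr (_ *: _); apply: eq_signr.
have := odd_index_rem us pst js; rewrite !oddD.
by do 6!case: (odd _).
Qed.

Lemma perm_singular_factor a s t : uniq s -> perm_eq s t ->
  sf a s = (-1) ^+ (inversions s + inversions t) *: sf a t.
Proof.
move=> us pst; rewrite /singular_factor -(perm_big _ pst) scaler_sumr.
rewrite [LHS]big_seq [RHS]big_seq; apply: eq_bigr => j js /=.
have E : (-1) ^+ index j s *: flag b (rem j s) =
    (-1) ^+ (inversions s + inversions t) *: ((-1) ^+ index j t *: flag b (rem j t)).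
  apply: (scalerI (a := (-1) ^+ inversions s)); first by rewrite signr_eq0.
  rewrite !scalerA -!exprD addnC (perm_signed_rem us pst js); congr (_ *: _).
  by apply: eq_signr; rewrite !oddD; do 3!case: (odd _).
by rewrite ![_ * a j]mulrC -!scalerA E scalerA [a j * _]mulrC -scalerA.
Qed.

Lemma singular_factor_cons a j s : j \notin s ->
  sf a (j :: s) = a j *: flag b s - wedge b (flag b [:: j]) (sf a s).
Proof.
move=> njs; rewrite /singular_factor big_cons /= eqxx mul1r; congr (_ + _).
rewrite linear_sumr -sumrN big_seq [RHS]big_seq; apply: eq_bigr => i is_.
have nij : j == i = false by apply: contraNF njs => /eqP ->.
rewrite linearZr_LR /= wedge_flag /= nij exprS mulN1r.
by rewrite mulNr scaleNr.
Qed.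

(** The Leibniz rule, as an identity between formal sums over [s ++ t]. *)
Lemma singular_factor_cat a s t : uniq (s ++ t) ->
  sf a (s ++ t) = wedge b (sf a s) (flag b t) +
                  (-1) ^+ size s *: wedge b (flag b s) (sf a t).
Proof.
rewrite cat_uniq => /and3P[us /hasPn nst ut].
rewrite {1}/singular_factor big_cat /=; congr (_ + _).
  rewrite /singular_factor linear_sumlz big_seq [RHS]big_seq; apply: eq_bigr => j js.
  by rewrite linearZl_LR /= wedge_flag index_cat rem_cat js.
rewrite /singular_factor linear_sumr scaler_sumr big_seq [RHS]big_seq.
apply: eq_bigr => j jt; have njs := nst _ jt.
by rewrite linearZr_LR /= wedge_flag index_cat rem_cat (negbTE njs) scalerA exprD mulrA.
Qed.

(** The square of the boundary vanishes.  Peeling off the first vertex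
    reduces the claim for a simplex to the claim for its opposite face, without
    pairing the terms. *)
Lemma singular_factor_singular_factor s : uniq s ->
  \sum_(i <- s) (-1) ^+ index i s *: sf1 (rem i s) = 0.
Proof.
elim: s => [|j s IH] /=; first by rewrite big_nil.
case/andP=> njs us; rewrite big_cons /= eqxx scale1r big_seq.
rewrite (eq_bigr (fun i => - ((-1) ^+ index i s *: flag b (rem i s)) +
   wedge b (flag b [:: j]) ((-1) ^+ index i s *: sf1 (rem i s)))); last first.
  move=> i is_; have nij : j == i = false by apply: contraNF njs => /eqP ->.
  rewrite nij exprS mulN1r singular_factor_cons; last first.
    by apply: contra njs => /mem_rem.
  by rewrite scale1r scaleNr scalerBr opprB addrC linearZr_LR.
rewrite big_split -!big_seq /= -linear_sumr IH // linear0r addr0 sumrN.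
by rewrite /singular_factor; under eq_bigr do rewrite mulr1; rewrite subrr.
Qed.

(** The simplicial boundary, extended linearly from flags of independent lists.  On
    a dependent list [s] the flag is 0 although its formal boundary
    [sf1 s] need not be: this is where singular elements come from. *)
Definition boundary u : flags K n := \sum_A u A *: sf1 (enum A).

Lemma boundary_linear : linear boundary.
Proof.
move=> c u v; rewrite /boundary scaler_sumr -big_split; apply: eq_bigr => A _ /=.
by rewrite !ffunE scalerDl scalerA.
Qed.

HB.instance Definition _ :=
  GRing.isLinear.Build K (flags K n) (flags K n) _ boundary boundary_linear.

Lemma boundary_flag s : indep b s -> boundary (flag b s) = sf1 s.
Proof.
move=> is_; have us := indep_uniq is_.
rewrite flagE // linearZ /= /boundary (bigD1 [set i in s]) //= big1 => [|A nA]; last first.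
  by rewrite ffunE (negbTE nA) scale0r.
rewrite addr0 ffunE eqxx scale1r.
rewrite [RHS](@perm_singular_factor _ s (enum [set i in s])) //.
  by rewrite inversions_enum addn0.
by rewrite perm_sym perm_enum_set.
Qed.

(** Independence of [s ++ t] is essential here: the product on the left is
    0 for a dependent list, while the right-hand side may be nonzero. *)
Lemma boundary_wedge_flag s t : indep b (s ++ t) ->
  boundary (wedge b (flag b s) (flag b t)) = wedge b (sf1 s) (flag b t) +
     (-1) ^+ size s *: wedge b (flag b s) (boundary (flag b t)).
Proof.
move=> ist; rewrite wedge_flag boundary_flag // singular_factor_cat ?(indep_uniq ist) //.
by rewrite boundary_flag // (indep_catr ist).
Qed.

(** The index lists of the distinguished elements: one entry dropped from each block. *)
Fixpoint transversals Ss : seq (seq 'I_n) :=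
  if Ss is s :: Ss' then [seq rem i s ++ t | i <- s, t <- transversals Ss'] else [:: [::]].

Lemma singular_element_span a Ss :
  singular_element b a Ss \in <<[seq flag b t | t <- transversals Ss]>>%VS.
Proof.
elim: Ss => [|s Ss IH]; first exact: memv_span1.
rewrite /singular_element /= -/(singular_element _ _ _) linear_sumlz.
rewrite big_seq; apply: memv_suml => i is_; rewrite linearZl_LR; apply: memvZ => /=.
elim/span_ind: IH => [|c x u /mapP[t tT ->] IH]; first by rewrite linear0r mem0v.
rewrite linearDr linearZr_LR /=; apply: memvD => //; apply: memvZ.
rewrite wedge_flag; apply: memv_span; apply: map_f; exact: allpairs_f.
Qed.

(** A product of boundaries is a cycle.  Independence of all transversals
    makes the Leibniz rule available at each factor. *)
Lemma boundary_singular_element Ss : all uniq Ss ->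
    (forall t, t \in transversals Ss -> indep b t) ->
  boundary (singular_element b (fun=> 1) Ss) = 0.
Proof.
elim: Ss => [|s Ss IH] /=.
  by move=> _ /(_ [::]) i0; rewrite boundary_flag ?i0 // /singular_factor big_nil.
case/andP=> us uSs iT.
rewrite /singular_element /= -/(singular_element _ _ _).
set v := singular_element _ _ _.
(* The tail [v] is a cycle too, so only the first factor contributes; that factor is
   a boundary, and the sum over [i] vanishes. *)
have L i : i \in s -> boundary (wedge b (flag b (rem i s)) v) = wedge b (sf1 (rem i s)) v.
  move=> is_; have iT' t : t \in transversals Ss -> indep b (rem i s ++ t).
    by move=> tT; apply: iT; apply: allpairs_f.
  have dv : boundary v = 0 by apply: IH => // t /iT' /indep_catr.
  suff -> : boundary (wedge b (flag b (rem i s)) v) = wedge b (sf1 (rem i s)) v +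
     (-1) ^+ size (rem i s) *: wedge b (flag b (rem i s)) (boundary v).
    by rewrite dv linear0r scaler0 addr0.
  move: (v) (singular_element_span (fun=> 1) Ss : v \in _).
  apply: span_ind => [|c x u /mapP[t tT ->] IHu].
    by rewrite !linear0r linear0 linear0r scaler0 addr0.
  rewrite linearPr linearP /= IHu boundary_wedge_flag ?iT' // linearPr linearP linearPr /=.
  rewrite !scalerDr !scalerA [c * _]mulrC -!addrA; congr (_ + _); exact: addrCA.
rewrite linear_sumlz linear_sum big_seq.
under eq_bigr => i is_ do rewrite linearZl_LR linearZ /= L // mulr1 -linearZl_LR /=.
by rewrite -big_seq -linear_sumlz singular_factor_singular_factor // linear0l.
Qed.

(** The change of coordinates that turns the weighted form into the standard one and
    the weighted singular factors into unweighted boundaries. *)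
Definition scale_flags a u : flags K n :=
  [ffun A : {set 'I_n} => (\prod_(i in A) a i) * u A].

Lemma scale_flags_linear a : linear (scale_flags a).
Proof.
move=> c u v; apply/ffunP => A; rewrite !ffunE mulrDr; congr (_ + _); exact: mulrCA.
Qed.

HB.instance Definition _ a :=
  GRing.isLinear.Build K (flags K n) (flags K n) _ (scale_flags a) (scale_flags_linear a).

Lemma scale_flags_flag a s : scale_flags a (flag b s) = (\prod_(i <- s) a i) *: flag b s.
Proof.
case: (boolP (indep b s)) => is_; last by rewrite flag_dep // linear0 scaler0.
rewrite flagE //; apply/ffunP => A; rewrite !ffunE; case: eqP => [->|_]; last first.
  by rewrite ![_ *: 0]mulr0 !mulr0.
congr (_ * _); rewrite (eq_bigl (mem s)) => [|i]; last by rewrite inE.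
by rewrite big_uniq // (indep_uniq is_).
Qed.

Lemma scale_flags_unit a A : scale_flags a (unit_flag K A) = (\prod_(i in A) a i) *: unit_flag K A.
Proof.
apply/ffunP => B; rewrite !ffunE; case: eqP => [->//|_]; by rewrite [_ *: _]mulr0 mulr0.
Qed.

Lemma scale_flags_wedge a u v :
  scale_flags a (wedge b u v) = wedge b (scale_flags a u) (scale_flags a v).
Proof.
rewrite (wedge_expandl b v u) {2}(flags_sum u) !linear_sum linear_sumlz.
apply: eq_bigr => A _; rewrite !linearZ linearZl_LR /=; congr (_ *: _).
rewrite (wedge_expandr b _ v) {2}(flags_sum v) !linear_sum linear_sumr.
apply: eq_bigr => B _; rewrite !linearZ /=; congr (_ *: _).
rewrite !scale_flags_unit linearZl_LR linearZr_LR /= wedge_unit scale_flags_flag.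
by rewrite big_cat /= !big_enum /= scalerA.
Qed.

(** Every term misses one index [j] of the flag and carries [a j] as its
    coefficient, so that rescaling produces the same product in all terms. *)
Lemma scale_flags_singular_factor a s : uniq s ->
  scale_flags a (sf a s) = (\prod_(i <- s) a i) *: sf1 s.
Proof.
move=> us; rewrite linear_sum scaler_sumr big_seq [RHS]big_seq; apply: eq_bigr => j js.
rewrite linearZ /= scale_flags_flag !scalerA (perm_big _ (perm_to_rem js)) big_cons.
by congr (_ *: _); rewrite mulr1 /=; ring.
Qed.

Lemma scale_flags_singular_element a Ss : all uniq Ss ->
  scale_flags a (singular_element b a Ss) =
  (\prod_(s <- Ss) \prod_(i <- s) a i) *: singular_element b (fun=> 1) Ss.
Proof.
elim: Ss => [|s Ss IH] /=.
  by rewrite /singular_element /= scale_flags_flag !big_nil.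
case/andP=> us uSs; rewrite /singular_element /= -!/(singular_element _ _ _).
rewrite scale_flags_wedge IH // scale_flags_singular_factor // linearZl_LR linearZr_LR /=.
by rewrite scalerA big_cons.
Qed.

Lemma flag_Vflag s : size s = k -> flag b s \in Vflag b.
Proof.
move=> sk; case: (boolP (indep b s)) => is_; last by rewrite flag_dep // mem0v.
have ps := perm_enum_set (indep_uniq is_).
rewrite (@perm_flag _ _ _ b s (enum [set i in s])); last by rewrite perm_sym.
apply: memvZ; apply: memv_span; apply: image_f; rewrite inE (perm_indep b ps) is_.
by rewrite -sk cardE (perm_size ps) /=.
Qed.

Lemma flag_at s A : indep b s -> flag b s A = (-1) ^+ inversions s * (A == [set i in s])%:R.
Proof. by move=> is_; rewrite flagE // !ffunE. Qed.

(** The boundary is the transpose of [flag_extensions]. *)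
Lemma boundary_at A B : indep b (enum B) ->
  boundary (flag b (enum B)) A = if indep b (enum A) then flag_extensions b (enum A) B else 0.
Proof.
move=> iB; rewrite boundary_flag // /singular_factor sum_ffunE big_enum /=.
case: ifPn => iA; last first.
  apply: big1 => j jB; have ir := indep_rem j iB.
  rewrite ffunE (flag_at _ ir); case: eqP => [eA|_]; last by rewrite mulr0 [_ *: _]mulr0.
  by case/negP: iA; rewrite eA indep_enum // (indep_uniq ir).
rewrite /flag_extensions sum_ffunE [RHS](bigID (mem B)) /= [X in _ = _ + X]big1 ?addr0.
  apply: eq_bigr => j jB; have ir := indep_rem j iB.
  have jE : j \in enum B by rewrite mem_enum.
  rewrite ffunE (flag_at _ ir).
  have eAB : (A == [set i in rem j (enum B)]) = (j \notin A) && (B == j |: A).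
    apply/eqP/andP => [->|[njA /eqP->]].
      rewrite inE mem_rem_uniq ?enum_uniq // inE /= eqxx; split=> //.
      apply/eqP/setP => i; rewrite !inE mem_rem_uniq ?enum_uniq // inE /= mem_enum.
      by case: eqP => [->|].
    apply/setP => i; rewrite !inE mem_rem_uniq ?enum_uniq // inE /= mem_enum !inE.
    by case: eqP => [->|]; rewrite // (negbTE njA).
  case: (boolP (indep b (j :: enum A))) => ijA; last first.
    rewrite flag_dep // [RHS]ffunE; case: eqP eAB => [eA|_ _]; last by rewrite mulr0 [_ *: _]mulr0.
    move=> /esym/andP[njA /eqP eB]; case/negP: ijA.
    have : perm_eq (j :: enum A) (enum B).
      apply: uniq_perm; rewrite /= ?mem_enum ?njA ?enum_uniq // => i.
      by rewrite eB !inE !mem_enum !inE.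
    by move=> /(@perm_indep _ _ _ b) ->.
  have njA : j \notin A by move: (indep_uniq ijA); rewrite /= mem_enum => /andP[].
  rewrite (flag_at _ ijA) eAB njA /=.
  have -> : [set i in j :: enum A] = j |: A by apply/setP => i; rewrite !inE mem_enum.
  case: (B =P j |: A) eAB => [eB|_] eAB; last by rewrite !mulr0 [_ *: _]mulr0.
  move: eAB; rewrite njA /= => /eqP eA; rewrite /= !mulr1 inversions_enum addn0 -[_ *: _]/(_ * _).
  rewrite -exprD; apply: eq_signr.
  rewrite -[X in odd (X + _)]addn0 -(inversions_enum B) oddD odd_index_inversions ?enum_uniq //.
  rewrite -oddD /= -addnA oddD addnn odd_double addbF; congr (odd _); apply/permP.
  by rewrite eA perm_sym perm_enum_set // rem_uniq ?enum_uniq.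
move=> j njB; case: (boolP (indep b (j :: enum A))) => ijA; last by rewrite flag_dep // ffunE.
rewrite (flag_at _ ijA); case: eqP => [eB|_]; last by rewrite mulr0.
by move: njB; rewrite eB inE mem_head.
Qed.

Lemma cform_flag_extensions a u A : indep b (enum A) ->
    scale_flags a u \in Vflag b ->
  cform b a u (flag_extensions b (enum A)) = boundary (scale_flags a u) A.
Proof.
move=> iA uV.
transitivity (\sum_(B in indep_sets b k) scale_flags a u B * flag_extensions b (enum A) B).
  by apply: eq_bigr => B _; rewrite ffunE mulrA.
elim/span_ind: uV => [|c x v /imageP[B Bk ->] IH].
  by rewrite linear0 ffunE; apply: big1 => B _; rewrite ffunE mul0r.
rewrite linearP !ffunE -IH /=.
rewrite (eq_bigr (fun C => c * (flag b (enum B) C * flag_extensions b (enum A) C) +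
    v C * flag_extensions b (enum A) C)); last first.
  by move=> C _; rewrite !ffunE mulrDl mulrA.
rewrite big_split /= -mulr_sumr; congr (c * _ + _).
have /andP[iB /eqP cB] : indep b (enum B) && (#|B| == k) by move: Bk; rewrite inE.
rewrite boundary_at // iA (bigD1 B) //= big1 => [|C /andP[_ nCB]].
  by rewrite addr0 flag_enum // ffunE eqxx mul1r.
by rewrite flag_enum // ffunE (negbTE nCB) mul0r.
Qed.

Lemma flag_span_Vflag (T : seq (seq 'I_n)) u : (forall t, t \in T -> size t = k) ->
  u \in <<[seq flag b t | t <- T]>>%VS -> u \in Vflag b.
Proof.
move=> sT; apply/subvP/span_subvP => _ /mapP[t /sT st ->]; exact: flag_Vflag.
Qed.

(** After rescaling, orthogonality to all extensions says that the boundary of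
    a cycle vanishes. *)
Lemma singular_element_Sing a Ss : all uniq Ss ->
    (forall t, t \in transversals Ss -> indep b t /\ size t = k) ->
  singular_element b a Ss \in Sing b a.
Proof.
move=> uSs tSs; have sT t : t \in transversals Ss -> size t = k by move=> /tSs[].
have SV a' := flag_span_Vflag sT (singular_element_span a' Ss).
rewrite memv_cap SV; apply/mem_orthovP.
apply: span_ind => [|c x u /imageP[A]].
  by rewrite linear0r.
rewrite inE => /andP[iA _] -> IH; rewrite linearPr /= IH addr0.
rewrite cform_flag_extensions // scale_flags_singular_element //.
  by rewrite linearZ /= boundary_singular_element ?scaler0 ?ffunE ?mulr0 // => t /tSs[].
by apply: memvZ.
Qed.

End Singular.

(** * Spans, and coordinates in a basis of the arrangement *)

Section Spans.
Variables (K : fieldType) (n k : nat) (b : 'M[K]_(n, k)).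
Implicit Types (s t : seq 'I_n) (A B : {set 'I_n}).

Definition sspan s : {vspace 'rV[K]_k} := <<[seq row i b | i <- s]>>%VS.

Lemma sspan_enum A : sspan (enum A) = gspan b A.
Proof. by []. Qed.

Lemma sspan_subP s (U : {vspace 'rV[K]_k}) :
  reflect {in s, forall i, row i b \in U} (sspan s <= U)%VS.
Proof.
apply: (iffP span_subvP) => [h i is_|h _ /mapP[i is_ ->]]; last exact: h.
exact/h/map_f.
Qed.

Lemma mem_sspan i s : i \in s -> row i b \in sspan s.
Proof. by move=> is_; apply/memv_span/map_f. Qed.

Lemma mem_gspan i A : i \in A -> row i b \in gspan b A.
Proof. by rewrite -mem_enum => /mem_sspan. Qed.

Lemma gspan_subP A (U : {vspace 'rV[K]_k}) :
  reflect {in A, forall i, row i b \in U} (gspan b A <= U)%VS.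
Proof.
by apply: (iffP (sspan_subP _ _)) => h i iA; apply: h; move: iA; rewrite mem_enum.
Qed.

Lemma gspanS A B : A \subset B -> (gspan b A <= gspan b B)%VS.
Proof. by move=> /subsetP sAB; apply/gspan_subP => i /sAB /mem_gspan. Qed.

Lemma sspan_cat s t : sspan (s ++ t) = (sspan s + sspan t)%VS.
Proof. by rewrite /sspan map_cat span_cat. Qed.

Lemma eq_sspan s t : s =i t -> sspan s = sspan t.
Proof. by move=> e; apply: eq_span => v; apply: eq_mem_map. Qed.

Lemma gspanU A B : gspan b (A :|: B) = (gspan b A + gspan b B)%VS.
Proof.
rewrite -!sspan_enum -sspan_cat; apply: eq_sspan => i.
by rewrite mem_cat !mem_enum in_setU.
Qed.

Lemma indep_dim s : indep b s = (\dim (sspan s) == size s).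
Proof. by rewrite /indep /free size_map. Qed.

Lemma dim_sspan s : indep b s -> \dim (sspan s) = size s.
Proof. by rewrite indep_dim => /eqP. Qed.

Lemma indep_cons j s : indep b (j :: s) = (row j b \notin sspan s) && indep b s.
Proof. exact: free_cons. Qed.

Lemma gspan_sum v A : v \in gspan b A -> exists c, v = \sum_(p in A) c p *: row p b.
Proof.
rewrite -sspan_enum /sspan; move: v; apply: span_ind => [|c x u /mapP[p]].
  by exists (fun=> 0); rewrite big1 // => p _; rewrite scale0r.
rewrite mem_enum => pA -> [d ->]; exists (fun q => c *+ (q == p) + d q).
rewrite [RHS](eq_bigr _ (fun _ _ => scalerDl _ _ _)) big_split /=; congr (_ + _).
rewrite (bigD1 p) //= eqxx big1 ?addr0 // => q /andP[_ /negbTE->].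
by rewrite mulr0n scale0r.
Qed.

Lemma sum_gspan c A : \sum_(p in A) c p *: row p b \in gspan b A.
Proof. by apply: memv_suml => p pA; apply/memvZ/mem_gspan. Qed.

Lemma sum_indep0 c A : indep b (enum A) -> \sum_(p in A) c p *: row p b = 0 ->
  {in A, forall p, c p = 0}.
Proof.
move=> iA s0 p pA; apply/eqP/negPn/negP => cp0.
have pP := perm_enum_setD1 pA.
move: iA; rewrite (perm_indep b pP) indep_cons => /andP[/negP[]].
move: s0; rewrite (bigD1 p) //= => /eqP; rewrite addr_eq0 => /eqP e.
have -> : row p b = (c p)^-1 *: (c p *: row p b) by rewrite scalerA mulVf // scale1r.
rewrite e sspan_enum; apply/memvZ; rewrite memvN; apply: memv_suml => q /andP[qA qp].
by apply/memvZ/mem_gspan; rewrite !inE qp.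
Qed.

End Spans.

Section Basis.
Variables (K : fieldType) (n k : nat) (b : 'M[K]_(n, k)) (I : {set 'I_n}).
Hypotheses (iI : indep b (enum I)) (cI : #|I| = k).
Implicit Types (s t P : seq 'I_n) (A B X : {set 'I_n}) (Js : seq {set 'I_n}).

(** For [j] outside [I], the fundamental circuit of [j] with respect to the
    basis [I], without [j] itself: the indices at which row [j] has a nonzero
    coordinate ([bsupp_coef]). *)
Definition bsupp (j : 'I_n) : {set 'I_n} :=
  [set p in I | row j b \notin gspan b (I :\ p)].

Lemma gspan_basis : gspan b I = fullv.
Proof.
by apply/eqP; rewrite eqEdim subvf /= dimvf /dim /= mul1n -sspan_enum dim_sspan // -cardE cI.
Qed.

Lemma indep_sub X : X \subset I -> indep b (enum X).
Proof.
move=> sXI; have: perm_eq (enum I) (enum X ++ enum (I :\: X)).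
  apply: uniq_perm; rewrite ?cat_uniq ?enum_uniq ?andbT //=.
    by apply/hasPn => i; rewrite !mem_enum inE => /andP[].
  move=> i; rewrite mem_cat !mem_enum inE; case: (boolP (i \in X)) => //= /(subsetP sXI) //.
by move=> /(perm_indep b); rewrite iI => /esym /indep_catl.
Qed.

Lemma bsupp_sub j : bsupp j \subset I.
Proof. by apply/subsetP => p; rewrite inE => /andP[]. Qed.

Lemma bsupp_coef j :
  exists2 c, row j b = \sum_(p in I) c p *: row p b & bsupp j = [set p in I | c p != 0].
Proof.
have /gspan_sum[c cE] : row j b \in gspan b I by rewrite gspan_basis memvf.
exists c => //; apply/setP => p; rewrite !inE; case: (boolP (p \in I)) => //= pI.
apply/idP/idP => [|cp0].
  apply: contra => /eqP cp0; rewrite cE (bigD1 p) //= cp0 scale0r add0r.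
  by apply: memv_suml => q /andP[qI qp]; apply/memvZ/mem_gspan; rewrite !inE qp.
apply/negP => /gspan_sum[d dE].
suff : c p - d p *+ (p != p) = 0 by rewrite eqxx subr0 => e; rewrite e eqxx in cp0.
apply: (sum_indep0 (c := fun q => c q - d q *+ (q != p)) iI) => //.
under eq_bigr do rewrite scalerBl.
rewrite sumrB -cE dE [X in _ - X](bigD1 p) //= eqxx mulr0n scale0r add0r.
rewrite (eq_bigl (fun q => (q \in I) && (q != p))) => [|q]; last by rewrite !inE andbC.
by apply/eqP; rewrite subr_eq0; apply/eqP/eq_bigr => q /andP[_ ->].
Qed.

Lemma bsupp_sum j : exists2 c, row j b = \sum_(p in bsupp j) c p *: row p b &
  {in bsupp j, forall p, c p != 0}.
Proof.
have [c cE sE] := bsupp_coef j; exists c; last by rewrite sE => p; rewrite inE => /andP[].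
rewrite {}cE {}sE (bigID (fun p => c p == 0)) /= big1 ?add0r => [|p /andP[_ /eqP->]].
  by apply: eq_bigl => p; rewrite inE.
by rewrite scale0r.
Qed.

(** Flats spanned by parts of the basis are governed by supports alone; this
    turns the conditions on subspaces into inclusions of subsets of [I]. *)
Lemma mem_gspan_bsupp j X : X \subset I -> (row j b \in gspan b X) = (bsupp j \subset X).
Proof.
move=> sXI; apply/idP/idP => [jX|sj].
  apply/subsetP => p; rewrite inE => /andP[pI]; apply: contraR => npX.
  apply: subvP jX; apply: gspanS; apply/subsetP => q qX; rewrite !inE (subsetP sXI) // andbT.
  by apply: contraNneq npX => <-.
have [c -> _] := bsupp_sum j; exact: subvP (gspanS b sj) _ (sum_gspan _ _ _).
Qed.

Lemma bsupp_basis p : p \in I -> bsupp p = [set p].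
Proof.
move=> pI; apply/eqP; rewrite eqEsubset -mem_gspan_bsupp ?sub1set // mem_gspan ?set11 //=.
rewrite inE pI /=; move: iI.
have pP := perm_enum_setD1 pI.
by rewrite (perm_indep b pP) indep_cons => /andP[].
Qed.

Section Extension.
Variables (X : {set 'I_n}) (P : seq 'I_n).
Hypotheses (sXI : X \subset I) (iP : indep b P) (sP : sspan b P = gspan b X).

Lemma size_span : size P = #|X|.
Proof. by rewrite -(dim_sspan iP) sP -sspan_enum dim_sspan ?indep_sub // -cardE. Qed.

Lemma indep_rcons_supp j : indep b (P ++ [:: j]) -> ~~ (bsupp j \subset X).
Proof.
rewrite (perm_indep b (perm_middle P j [::])) cats0 indep_cons sP.
by rewrite mem_gspan_bsupp // => /andP[].
Qed.

(** Row [j] lies in the span of [X] and of its support, so the product of [P] with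
    a whole block, nothing dropped, vanishes. *)
Lemma dependent_supp j : ~~ indep b (P ++ j :: enum (bsupp j :\: X)).
Proof.
rewrite (perm_indep b (perm_middle _ _ _)) indep_cons.
rewrite sspan_cat sP sspan_enum -gspanU mem_gspan_bsupp.
  rewrite negb_and negbK; apply/orP; left; apply/subsetP => p pj.
  by rewrite in_setU in_setD pj andbT orbN.
by rewrite subUset sXI (subset_trans (subsetDl _ _)) ?bsupp_sub.
Qed.

(** Steinitz exchange in the fundamental circuit of [j], relative to [X].  It says
    that whichever element of a new block is dropped, the kept ones extend [P] to a
    basis of the same next subspace; hence the rest of the chain is available
    for each of these choices. *)
Lemma basis_exchange j i : j \notin I -> i \in j :: enum (bsupp j :\: X) ->
  indep b (P ++ rem i (j :: enum (bsupp j :\: X))) /\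
  sspan b (P ++ rem i (j :: enum (bsupp j :\: X))) = gspan b (X :|: bsupp j).
Proof.
move=> jI; set L := enum _ => iL.
have sXj : X :|: bsupp j \subset I by rewrite subUset sXI bsupp_sub.
have sE : sspan b (P ++ rem i (j :: L)) = gspan b (X :|: bsupp j).
  rewrite sspan_cat sP; apply/eqP; rewrite eqEsubv subv_add gspanS ?subsetUl // andTb.
  apply/andP; split.
    apply/sspan_subP => q /mem_rem; rewrite inE => /orP[/eqP->|].
      by rewrite mem_gspan_bsupp // subsetUr.
    by rewrite mem_enum in_setD => /andP[_ qj]; apply: mem_gspan; rewrite in_setU qj orbT.
  set U := (_ + _)%VS.
  have XU q : q \in X -> row q b \in U by move=> qX; apply: subvP (addvSl _ _) _ (mem_gspan _ qX).
  have LU q : q \in rem i (j :: L) -> row q b \in U.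
    by move=> qL; apply: subvP (addvSr _ _) _ (mem_sspan _ qL).
  have LiU q : q \in bsupp j -> q != i -> row q b \in U.
    move=> qj qi; case: (boolP (q \in X)) => [/XU//|nqX]; apply: LU.
    by apply: rem_mem => //; rewrite in_cons mem_enum in_setD nqX qj orbT.
  apply/gspan_subP => q; rewrite in_setU => /orP[/XU//|qj].
  case: (eqVneq q i) => [qi|]; last exact: LiU.
  case: (boolP (q \in X)) => [/XU//|nqX].
  have [c cE /(_ _ qj) cq0] := bsupp_sum j.
  have -> : row q b = (c q)^-1 *: (row j b - \sum_(p in bsupp j | p != q) c p *: row p b).
    by rewrite cE (bigD1 q) //= addrK scalerA mulVf // scale1r.
  apply/memvZ/memvB; last by apply: memv_suml => p /andP[pj pq]; apply/memvZ/LiU; rewrite -?qi.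
  apply: LU; apply: rem_mem; rewrite ?mem_head //.
  by apply: contraNneq jI => ->; rewrite -qi (subsetP (bsupp_sub j)).
split=> //; rewrite indep_dim sE -sspan_enum dim_sspan ?indep_sub // -cardE.
rewrite size_cat size_rem //= size_span -cardE.
by rewrite cardsU cardsD [_ :&: X]setIC addnBA ?subset_leq_card ?subsetIr.
Qed.

End Extension.
End Basis.

(** * Chains of blocks and the expansion of a flag *)

Section Chains.
Variables (K : fieldType) (n k : nat) (b : 'M[K]_(n, k)) (a : 'I_n -> K) (I : {set 'I_n}).
Hypotheses (iI : indep b (enum I)) (cI : #|I| = k).
Implicit Types (s t P : seq 'I_n) (A B X : {set 'I_n}) (Js : seq {set 'I_n}).

Local Notation supp := (bsupp b I).

Definition step_block X j := j |: (supp j :\: X).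

Inductive block_chain : {set 'I_n} -> seq {set 'I_n} -> Prop :=
| Chain_nil : block_chain I [::]
| Chain_cons X j Js : X \subset I -> j \notin I -> ~~ (supp j \subset X) ->
    block_chain (X :|: supp j) Js -> block_chain X (step_block X j :: Js).

Definition steps X := [set j | (j \notin I) && ~~ (supp j \subset X)].

(** The same chains as a list, so as to sum over them; [m] bounds the number of
    steps, and [#|I :\: X|] steps suffice. *)
Fixpoint chain_list m X : seq (seq {set 'I_n}) :=
  if X == I then [:: [::]] else
  if m is m'.+1 then
    [seq step_block X j :: Js | j <- enum (steps X), Js <- chain_list m' (X :|: supp j)]
  else [::].

Lemma setU_supp_sub X j : X \subset I -> X :|: supp j \subset I.
Proof. by move=> sXI; rewrite subUset sXI bsupp_sub. Qed.

Lemma perm_enum_extension X j :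
  perm_eq (enum (supp j :\: X) ++ enum (I :\: (X :|: supp j))) (enum (I :\: X)).
Proof.
apply: uniq_perm; rewrite ?enum_uniq ?cat_uniq ?enum_uniq ?andbT //=.
  apply/hasPn => i; rewrite !mem_enum !in_setD in_setU negb_or.
  by case/andP=> /andP[_ /negbTE->]; rewrite andbF.
move=> i; rewrite mem_cat !mem_enum !in_setD in_setU; case: (i \in X) => //=.
by case: (boolP (i \in supp j)) => // /(subsetP (bsupp_sub b I j)) ->.
Qed.

Lemma card_extension m X j : ~~ (supp j \subset X) ->
  (#|I :\: X| <= m.+1)%N -> (#|I :\: (X :|: supp j)| <= m)%N.
Proof.
move=> /subsetPn[p pj npX] cm; rewrite -ltnS; apply: leq_trans cm; apply: proper_card.
apply/properP; split; first by rewrite setDS // subsetUl.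
by exists p; rewrite in_setD ?npX ?(subsetP (bsupp_sub b I j)) // in_setU pj orbT.
Qed.

Lemma chain_list_chain m X Js : X \subset I -> Js \in chain_list m X -> block_chain X Js.
Proof.
elim: m X Js => [|m IH] X Js sXI /=; case: eqP => [->|_] //.
- by rewrite inE => /eqP->; apply: Chain_nil.
- by rewrite inE => /eqP->; apply: Chain_nil.
case/allpairsPdep=> j [Js' [+ J' ->]]; rewrite mem_enum inE => /andP[njI nj].
by apply: Chain_cons => //; apply: IH => //; apply: setU_supp_sub.
Qed.

Lemma chain_in_chain_list m X Js : block_chain X Js -> (#|I :\: X| <= m)%N -> Js \in chain_list m X.
Proof.
move=> c; elim: c m => [|{}X j {}Js sXI njI nj _ IH] m.
  by case: m => [|m] _ /=; rewrite eqxx inE.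
have nXI : X != I by apply: contraNneq nj => ->; apply: bsupp_sub.
case: m => [|m] /=.
  by rewrite leqn0 cards_eq0 setD_eq0 => sIX; rewrite (subset_trans _ sIX) ?bsupp_sub in nj.
rewrite (negbTE nXI) => cm; apply/allpairsPdep; exists j, Js; split=> //.
  by rewrite mem_enum inE njI.
exact/IH/card_extension.
Qed.

Lemma block_setD X j : j \notin I -> step_block X j :\: I = [set j].
Proof.
move=> njI; apply/setP => i; rewrite in_setD in_setU1 in_setD in_set1.
case: eqP => [->|_] /=; first by rewrite njI.
by case: (boolP (i \in supp j)) => [/(subsetP (bsupp_sub b I j))->|]; rewrite ?andbF.
Qed.

Lemma block_setI X j : j \notin I -> step_block X j :&: I = supp j :\: X.
Proof.
move=> njI; apply/setP => i; rewrite in_setI in_setU1 in_setD.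
case: eqP => [->|_] /=.
  by rewrite (negbTE njI) (contraNF (subsetP (bsupp_sub b I j) j)) ?andbF.
by apply: andb_idr => /andP[_]; apply/subsetP/bsupp_sub.
Qed.

(** The ordering of a block that puts the index outside [I] first, so that the
    leading term of the singular factor is the one that makes up [flag b I]. *)
Definition block_seq A : seq 'I_n := enum (A :\: I) ++ enum (A :&: I).

Lemma block_seq_block X j : j \notin I -> block_seq (step_block X j) = j :: enum (supp j :\: X).
Proof. by move=> njI; rewrite /block_seq block_setD // block_setI // enum_set1. Qed.

Definition kept Js : seq 'I_n := flatten [seq enum (A :&: I) | A <- Js].

Lemma kept_perm X Js : block_chain X Js -> perm_eq (kept Js) (enum (I :\: X)).
Proof.
elim=> [|{}X j {}Js sXI njI nj _ IH] /=; first by rewrite setDv enum_set0.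
rewrite /kept /= block_setI // (permPl (perm_cat (perm_refl _) IH)).
exact: perm_enum_extension.
Qed.

Definition singular_of Js : flags K n := singular_element b a [seq block_seq A | A <- Js].

Lemma transversals_chain X Js P : block_chain X Js -> indep b P -> sspan b P = gspan b X ->
  forall t, t \in transversals [seq block_seq A | A <- Js] ->
  indep b (P ++ t) /\ size (P ++ t) = k.
Proof.
move=> c; elim: c P => [|{}X j {}Js sXI njI nj _ IH] P iP sP t /=.
  by rewrite inE => /eqP->; rewrite cats0 (size_span iI (subxx _) iP sP).
rewrite block_seq_block //.
case/allpairsP=> [[i t'] /= [iL t'T ->]].
have [iP' sP'] := basis_exchange iI cI sXI iP sP njI iL.
by rewrite catA; apply: IH.
Qed.

Lemma uniq_block_seq A : uniq (block_seq A).
Proof.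
rewrite cat_uniq !enum_uniq andbT; apply/hasPn => i.
by rewrite !mem_enum !inE => /andP[_ ->].
Qed.

Lemma singular_of_Sing Js : block_chain set0 Js -> singular_of Js \in Sing b a.
Proof.
move=> c; apply: singular_element_Sing.
  by apply/allP => _ /mapP[A _ ->]; apply: uniq_block_seq.
apply: (@transversals_chain set0 Js [::] c); first exact: nil_free.
by rewrite -sspan_enum enum_set0.
Qed.

(** The weight a(J_lambda, J, h) when [X] spans X_h^*, and a_J when [X] is empty
    (all rows being nonzero). *)
Definition tail_weight X : K := \sum_(j | ~~ (supp j \subset X)) a j.

Fixpoint chain_weight X Js : K :=
  if Js is A :: Js' then tail_weight X * chain_weight (X :|: (A :&: I)) Js' else 1.

(** [Sing] only imposes the relations on increasing lists; they follow for
    all lists by antisymmetry, and are trivial for dependent ones. *)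
Lemma flag_extensions_Sing v s : v \in Sing b a -> size s = k.-1 ->
  cform b a (flag_extensions b s) v = 0.
Proof.
move=> vS sk; case: (boolP (indep b s)) => is_; last first.
  rewrite /flag_extensions big1 ?linear0l // => j _; apply: flag_dep.
  by apply: contra is_; rewrite -cat1s => /indep_catr.
have ps := perm_enum_set (indep_uniq is_).
have -> : flag_extensions b s = (-1) ^+ inversions s *: flag_extensions b (enum [set i in s]).
  rewrite /flag_extensions scaler_sumr; apply: eq_bigr => j _.
  rewrite (@perm_flag _ _ _ b (j :: s) (j :: enum [set i in s])); last first.
    by rewrite perm_cons perm_sym.
  congr (_ *: _); rewrite /= inversions_enum addn0 (permP ps).
  by apply: eq_signr; rewrite !oddD; do 2!case: (odd _).
rewrite linearZl_LR /= cformC.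
have /mem_orthovP -> : v \in orthov (cform b a : {symmetric flags K n})
     <<[seq flag_extensions b (enum A) | A : {set 'I_n} in indep_sets b k.-1]>>%VS.
- by move: vS; rewrite memv_cap => /andP[].
- by rewrite mulr0.
apply: memv_span; apply: image_f; rewrite inE (perm_indep b ps) is_ -sk.
by rewrite cardE (perm_size ps) /=.
Qed.

(** The sets that occur along chains.  The second condition says that the flat
    spanned by [X] has no coloop, which is what makes its edge at infinity dense. *)
Definition chain_closed X := X \subset I /\
  {in X, forall p, exists j, [/\ j \notin I, p \in supp j & supp j \subset X]}.

Lemma chain_closed_sub X : chain_closed X -> X \subset I.
Proof. by case. Qed.

Lemma chain_closed0 : chain_closed set0.
Proof. by split=> [|p]; rewrite ?sub0set ?inE. Qed.

Lemma chain_closed_step X j : chain_closed X -> j \notin I -> chain_closed (X :|: supp j).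
Proof.
case=> sXI cX njI; split=> [|p]; first exact: setU_supp_sub.
rewrite in_setU => /orP[/cX[i [niI pi siX]]|pj].
  by exists i; split=> //; apply: subset_trans siX (subsetUl _ _).
by exists j; rewrite subsetUr.
Qed.

Section Projection.
Variable v : flags K n.
Hypothesis (vS : v \in Sing b a).

Local Notation pair u := (cform b a u v).

(** The relations of [Sing] with the summed index at any fixed position. *)
Lemma pair_insert P s : size (P ++ s) = k.-1 ->
  \sum_j pair (flag b (P ++ j :: s)) = 0.
Proof.
move=> sk; transitivity ((-1) ^+ size P * pair (flag_extensions b (P ++ s))); last first.
  by rewrite flag_extensions_Sing // mulr0.
rewrite linear_sumlz mulr_sumr; apply: eq_bigr => j _.
by rewrite flag_middle linearZl_LR.
Qed.

Lemma pair_singular_factor P s u :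
  pair (wedge b (flag b P) (wedge b (singular_factor b a s) u)) =
  \sum_(i <- s) ((-1) ^+ index i s * a i) * pair (wedge b (flag b (P ++ rem i s)) u).
Proof.
rewrite [wedge b (singular_factor b a s) u]linear_sumlz.
rewrite [wedge b (flag b P) _]linear_sumr [cform b a _ v]linear_sumlz.
by apply: eq_bigr => i _; rewrite linearZl_LR linearZr_LR linearZl_LR /= wedge_flagA.
Qed.

Section Step.
Variables (X : {set 'I_n}) (P : seq 'I_n).
Hypotheses (sXI : X \subset I) (iP : indep b P) (sP : sspan b P = gspan b X).

Local Notation Q := (enum (I :\: X)).
Local Notation sf := (singular_factor b a).

Let front j := pair (wedge b (flag b (P ++ [:: j])) (sf Q)).

Lemma front_sum j :
  front j = \sum_(p <- Q) (-1) ^+ index p Q * a p * pair (flag b (P ++ j :: rem p Q)).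
Proof.
rewrite /front linear_sumr linear_sumlz; apply: eq_bigr => p _.
by rewrite linearZr_LR linearZl_LR /= wedge_flag -catA.
Qed.

Lemma size_ext : size (P ++ Q) = k.
Proof.
rewrite size_cat -cardE (size_span iI sXI iP sP) cardsD (setIidPr sXI) -cI subnKC //.
exact: subset_leq_card.
Qed.

Lemma sum_front : \sum_j front j = 0.
Proof.
under eq_bigr do rewrite front_sum.
rewrite exchange_big /= big_seq big1 // => p pQ; rewrite -mulr_sumr pair_insert ?mulr0 //.
by rewrite -size_ext !size_cat size_rem // -!subn1 addnBA // (perm_size (perm_to_rem pQ)).
Qed.

Lemma front_closed j : supp j \subset X -> front j = 0.
Proof.
move=> sjX; rewrite /front flag_dep ?linear0l //.
by apply: contraL sjX => /(indep_rcons_supp iI cI sXI sP).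
Qed.

Lemma front_basis j : j \in I :\: X -> front j = a j * pair (flag b (P ++ Q)).
Proof.
rewrite -mem_enum => jQ; rewrite front_sum (perm_big _ (perm_to_rem jQ)) big_cons /=.
rewrite big_seq big1 ?addr0 => [|p].
  have -> : flag b (P ++ Q) = (-1) ^+ index j Q *: flag b (P ++ j :: rem j Q).
    by rewrite -!wedge_flag -[flag b Q](flag_cons_rem b _ jQ) ?enum_uniq // linearZr_LR.
  by rewrite linearZl_LR /=; ring.
rewrite mem_rem_uniq ?enum_uniq // inE => /andP[/= pj pQ].
rewrite flag_dep ?linear0l ?mulr0 //; apply/negP => /indep_catr /indep_uniq /=.
by rewrite rem_mem // eq_sym.
Qed.

(** The combinatorial heart.  The terms [a j] sum up over the admissible [j].  The
    exchange terms are relations of [Sing] lacking the indices [j] in [I] outside [X],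
    and those missing terms supply the weights [a j] of exactly these [j]. *)
Lemma step_sum :
  \sum_(j in steps X) pair (wedge b (flag b P) (sf (j :: Q))) =
  tail_weight X * pair (flag b (P ++ Q)).
Proof.
have E j : j \in steps X -> pair (wedge b (flag b P) (sf (j :: Q))) =
    a j * pair (flag b (P ++ Q)) - front j.
  rewrite inE => /andP[njI _]; rewrite singular_factor_cons; last first.
    by rewrite mem_enum in_setD (negbTE njI) andbF.
  by rewrite linearBr linearBl linearZr_LR linearZl_LR /= wedge_flag wedge_flagA.
rewrite (eq_bigr _ E) sumrB -mulr_suml.
(* Among all [j], those in the span of [P] contribute 0; the others are the admissible
   ones and the elements of [I] outside [X]. *)
have H : \sum_(j in steps X) front j =
    - ((\sum_(j | ~~ (supp j \subset X) && (j \in I)) a j) * pair (flag b (P ++ Q))).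
  have := sum_front; rewrite (bigID (fun j => supp j \subset X)) /=.
  rewrite big1 ?add0r => [|j]; last exact: front_closed.
  rewrite (bigID (mem I)) /= addrC => /eqP; rewrite addr_eq0 => /eqP e.
  transitivity (\sum_(j | ~~ (supp j \subset X) && (j \notin I)) front j).
    by apply: eq_bigl => j; rewrite inE andbC.
  rewrite e mulr_suml; congr (- _); apply: eq_bigr => j /andP[nj jI]; rewrite front_basis //.
  by rewrite in_setD jI andbT; move: nj; rewrite bsupp_basis // sub1set.
rewrite H opprK -mulrDl; congr (_ * _).
rewrite /tail_weight [RHS](bigID (mem I)) /= addrC; congr (_ + _).
by apply: eq_bigl => j; rewrite inE andbC.
Qed.

(** The sum over a block, multiplied by the remaining basis vectors, is the sum
    over all of [j :: Q]: by the Leibniz rule the difference contains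
    the whole block as a factor and vanishes. *)
Lemma step_wedge j (R := enum (I :\: (X :|: supp j))) (L := enum (supp j :\: X)) : j \notin I ->
  (-1) ^+ crossings L R * pair (wedge b (flag b P) (wedge b (sf (j :: L)) (flag b R))) =
  pair (wedge b (flag b P) (sf (j :: Q))).
Proof.
move=> njI.
have pLR : perm_eq (L ++ R) Q := perm_enum_extension X j.
have pj : perm_eq (j :: Q) (j :: L ++ R) by rewrite perm_cons perm_sym.
have uj : uniq (j :: Q) by rewrite /= enum_uniq mem_enum in_setD (negbTE njI) andbF.
rewrite (perm_singular_factor b a uj pj) linearZr_LR linearZl_LR /=.
congr (_ * _).
  apply: eq_signr; rewrite inversions_cat !inversions_enum !add0n addn0.
  by rewrite -(permP pLR) addnA addnn oddD odd_double.
have ujLR : uniq ((j :: L) ++ R) by rewrite -(perm_uniq pj).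
rewrite -cat_cons (singular_factor_cat b a ujLR) linearDr linearZr_LR /=.
by rewrite wedge_flagA (flag_dep (dependent_supp iI cI sXI sP j)) linear0l scaler0 addr0.
Qed.

End Step.

(** Induction on the number of steps.  The statement for all [P] with the span of
    [X] is needed, because dropping different elements of the first block leads to
    different lists with the same span. *)
Lemma projection_expansion m X P :
    (forall X, chain_closed X -> X != I -> tail_weight X != 0) -> chain_closed X ->
    (#|I :\: X| <= m)%N -> indep b P -> sspan b P = gspan b X ->
  pair (flag b (P ++ enum (I :\: X))) =
  \sum_(Js <- chain_list m X) (-1) ^+ inversions (kept Js) / chain_weight X Js *
     pair (wedge b (flag b P) (singular_of Js)).
Proof.
move=> tw; elim: m X P => [|m IH] X P cX cm iP sP;
  have sXI := chain_closed_sub cX; rewrite /=; have [XI|XI] := eqVneq X I.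
- by rewrite XI big_seq1 /singular_of /singular_element /= wedge_flag setDv enum_set0
    /kept /= invr1 !mul1r.
- by case/eqP: XI; apply/eqP; rewrite eqEsubset sXI -setD_eq0 -cards_eq0 -leqn0.
- by rewrite XI big_seq1 /singular_of /singular_element /= wedge_flag setDv enum_set0
    /kept /= invr1 !mul1r.
(* One step of the chain contributes the sign of moving the kept part of the block
   and the factor [tail_weight]. *)
have arith (u x y w c z : K) : u != 0 -> u * (y * x / (u * w) * (c * z)) = x * c * (y / w * z).
  move=> u0; rewrite invfM; transitivity ((u * u^-1) * (x * c * (y / w * z))); first by ring.
  by rewrite divff // mul1r.
apply: (mulfI (tw X cX XI)); rewrite -step_sum // mulr_sumr big_allpairs_dep /= big_enum /=.
apply: eq_bigr => j; rewrite inE => /andP[njI nj].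
rewrite -step_wedge //.
set L := enum (supp j :\: X); set R := enum _.
have cXj := chain_closed_step cX njI.
have cmj := card_extension nj cm.
rewrite big_seq.
rewrite (eq_bigr (fun Js => \sum_(i <- j :: L) (-1) ^+ crossings L R *
   ((-1) ^+ index i (j :: L) * a i) *
   ((-1) ^+ inversions (kept Js) / chain_weight (X :|: supp j) Js *
    pair (wedge b (flag b (P ++ rem i (j :: L))) (singular_of Js))))); last first.
  move=> Js JsC; have cJs := chain_list_chain (chain_closed_sub cXj) JsC.
  rewrite /singular_of /singular_element /= -/(singular_element _ _ _) -/(singular_of _).
  rewrite block_seq_block // -/L block_setI // {1}/kept /= block_setI // -/L -/(kept Js).
  rewrite inversions_cat inversions_enum add0n.
  rewrite (perm_crossings (perm_refl _) (kept_perm cJs)) -/R exprD.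
  have -> : X :|: (supp j :\: X) = X :|: supp j.
    by apply/setP => i; rewrite !in_setU in_setD; case: (i \in X).
  rewrite pair_singular_factor !mulr_sumr; apply: eq_bigr => i _.
  exact: arith (tw X cX XI).
rewrite -big_seq exchange_big /= pair_singular_factor mulr_sumr.
rewrite big_seq [RHS]big_seq; apply: eq_bigr => i iL; rewrite -mulr_sumr.
have [iP' sP'] := basis_exchange iI cI sXI iP sP njI iL.
by rewrite -IH // wedge_flag mulrA.
Qed.

End Projection.
End Chains.

(** * Elementary subarrangements through a flag are chains *)

Section Elementary.
Variables (K : fieldType) (n k : nat) (b : 'M[K]_(n, k)).
Implicit Types (X Y A B : {set 'I_n}) (Js Ks : seq {set 'I_n}).

Definition elementary_step Y l A :=
  [&& (0 < #|A|)%N, \dim (gspan b (Y :|: A)) == (l + #|A|.-1)%N &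
      [forall j in A, \dim (gspan b ((Y :|: A) :\ j)) == (l + #|A|.-1)%N]].

(** The rank conditions (i) and (ii) in recursive form, relative to the union [Y]
    of the earlier blocks and its rank [l]. *)
Fixpoint elementary_from Y l Js : bool :=
  if Js is A :: Js' then
    elementary_step Y l A && elementary_from (Y :|: A) (l + #|A|.-1)%N Js'
  else true.

Lemma Jcup_cons A Js h : Jcup (A :: Js) h.+1 = A :|: Jcup Js h.
Proof. by rewrite /Jcup /= big_cons. Qed.

Lemma Jcup0 Js : Jcup Js 0 = set0.
Proof. by rewrite /Jcup take0 big_nil. Qed.

Lemma elementary_fromP Y l Js : elementary_from Y l Js <->
  (forall h, (h < size Js)%N ->
     [&& #|nth set0 Js h| == (nth 0%N (etype Js) h).+1,
         \dim (gspan b (Y :|: Jcup Js h.+1)) == (l + sumn (take h.+1 (etype Js)))%N &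
         [forall j in nth set0 Js h,
            \dim (gspan b ((Y :|: Jcup Js h.+1) :\ j)) ==
            (l + sumn (take h.+1 (etype Js)))%N]]).
Proof.
elim: Js Y l => [|A Js IH] Y l //=.
have E1 : elementary_step Y l A =
    [&& #|A| == #|A|.-1.+1,
         \dim (gspan b (Y :|: Jcup (A :: Js) 1)) ==
           (l + (#|A|.-1 + sumn (take 0 (etype Js))))%N &
         [forall j in A, \dim (gspan b ((Y :|: Jcup (A :: Js) 1) :\ j)) ==
            (l + (#|A|.-1 + sumn (take 0 (etype Js))))%N]].
  rewrite Jcup_cons Jcup0 setU0 take0 addn0 /elementary_step; congr (_ && _).
  by case: #|A| => //= m; rewrite eqxx.
split=> [/andP[eA /IH e] [|h] /= hs|e].
- by rewrite -E1.
- by have := e h hs; rewrite !Jcup_cons !setUA addnA.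
apply/andP; split; first by rewrite E1 (e 0%N).
by apply/IH => h hs; have := e h.+1 hs; rewrite /= !Jcup_cons !setUA addnA.
Qed.

Lemma elementaryE Js : elementary b (etype Js) Js =
  [&& all (fun l => (0 < l)%N) (etype Js), sumn (etype Js) == k,
      pairwise (fun A B : {set 'I_n} => [disjoint A & B]) Js & elementary_from set0 0 Js].
Proof.
rewrite /elementary size_map eqxx /=; do 3!congr (_ && _).
apply/forallP/idP => [h|/elementary_fromP h i].
  apply/elementary_fromP => i iJ.
  by have := h (Ordinal iJ); rewrite /= !set0U.
by have := h i (ltn_ord i); rewrite !set0U.
Qed.

Variable (I : {set 'I_n}).
Hypotheses (iI : indep b (enum I)) (cI : #|I| = k).
Local Notation supp := (bsupp b I).
Local Notation chain := (block_chain b I).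
Local Notation block := (step_block b I).

Lemma setU_block X j : X :|: (supp j :\: X) = X :|: supp j.
Proof. by apply/setP => i; rewrite !in_setU in_setD; case: (i \in X). Qed.

Lemma gspan_block X Y j : X \subset I -> gspan b Y = gspan b X ->
  gspan b (Y :|: block X j) = gspan b (X :|: supp j).
Proof.
move=> sXI eY; rewrite gspanU eY -gspanU; apply/eqP; rewrite eqEsubv; apply/andP; split.
  apply/gspan_subP => i; rewrite in_setU in_setU1 in_setD => /or3P[iX|/eqP->|/andP[_ ij]].
  - by apply: mem_gspan; rewrite in_setU iX.
  - by rewrite (mem_gspan_bsupp iI cI) ?setU_supp_sub // subsetUr.
  - by apply: mem_gspan; rewrite in_setU ij orbT.
by apply: gspanS; rewrite -setU_block setUS // subsetUr.
Qed.

Lemma card_block X j : j \notin I -> #|block X j| = #|supp j :\: X|.+1.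
Proof.
move=> njI; rewrite cardsU1 in_setD (contraNF (subsetP (bsupp_sub b I j) j) njI).
by rewrite andbF.
Qed.

Lemma card_extend X j : j \notin I -> #|X :|: supp j| = (#|X| + #|block X j|.-1)%N.
Proof.
move=> njI; rewrite card_block //= cardsU cardsD [_ :&: X]setIC.
by rewrite addnBA ?subset_leq_card ?subsetIr.
Qed.

(** The element of a new block outside [I] is not in the span of [Y]. *)
Lemma chain_block_disjoint X Y j : j \notin I -> ~~ (supp j \subset X) -> X \subset I ->
  gspan b Y = gspan b X -> Y :&: I \subset X -> [disjoint Y & block X j].
Proof.
move=> njI nj sXI eY sYX; rewrite disjoint_sym; apply/pred0P => i /=; apply/negbTE.
rewrite in_setU1 in_setD; apply/negP => /andP[/orP[/eqP->|/andP[niX ij]] iY].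
  by case/negP: nj; rewrite -(mem_gspan_bsupp iI cI) // -eY mem_gspan.
case/negP: niX; apply: (subsetP sYX).
by rewrite in_setI iY (subsetP (bsupp_sub b I j)).
Qed.

Lemma setI_extension X Y j : j \notin I -> Y :&: I \subset X ->
  (Y :|: block X j) :&: I \subset X :|: supp j.
Proof.
move=> njI sYX; rewrite setIUl block_setI // setUSS // subDset subsetUr //.
Qed.

(** The set [Y] stands for the union of the earlier blocks; besides [X] it
    contains their elements outside [I], which do not change the span. *)
Lemma chain_elementary_from X Y Js : chain X Js ->
  gspan b Y = gspan b X -> Y :&: I \subset X -> elementary_from Y #|X| Js.
Proof.
move=> c; elim: c Y => [|{}X j {}Js sXI njI nj _ IH] Y //= eY sYX.
have sXj := setU_supp_sub b j sXI.
have dE : \dim (gspan b (X :|: supp j)) = (#|X| + #|block X j|.-1)%N.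
  by rewrite -card_extend // -sspan_enum dim_sspan ?(indep_sub iI) // -cardE.
apply/andP; split; last first.
  by rewrite -card_extend //; apply: IH; rewrite ?gspan_block // setI_extension.
apply/and3P; split; first by rewrite card_block.
  by rewrite gspan_block // dE.
apply/forall_inP => i iA; rewrite -dE; apply/eqP; congr (\dim _).
have iYF : i \in Y = false.
  have := chain_block_disjoint njI nj sXI eY sYX.
  by rewrite disjoint_sym => /disjointFr ->.
have iL : i \in j :: enum (supp j :\: X).
  by move: iA; rewrite in_setU1 in_cons mem_enum.
have [_ <-] := basis_exchange iI cI sXI (indep_sub iI sXI) (sspan_enum b X) njI iL.
rewrite sspan_cat sspan_enum -eY -!sspan_enum -sspan_cat; apply: eq_sspan => p.
have uL : uniq (j :: enum (supp j :\: X)).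
  by rewrite /= enum_uniq mem_enum in_setD (contraNF (subsetP (bsupp_sub b I j) j) njI) andbF.
rewrite mem_cat !mem_enum mem_rem_uniq // in_setD1 in_setU in_setU1.
rewrite -[X in _ = _ || X]/((p != i) && (p \in j :: enum (supp j :\: X))) in_cons mem_enum.
by case: eqP => [->|_] //=; rewrite iYF.
Qed.

Lemma chain_disjoint X Y Js : chain X Js -> gspan b Y = gspan b X -> Y :&: I \subset X ->
  pairwise (fun A B : {set 'I_n} => [disjoint A & B]) Js &&
  all (fun A : {set 'I_n} => [disjoint Y & A]) Js.
Proof.
move=> c; elim: c Y => [|{}X j {}Js sXI njI nj _ IH] Y //= eY sYX.
have /andP[-> d] := IH (Y :|: block X j) (gspan_block j sXI eY) (setI_extension njI sYX).
have sub (Z : {set 'I_n}) : Z \subset Y :|: block X j ->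
    all (fun A : {set 'I_n} => [disjoint Z & A]) Js.
  by move=> sZ; apply: sub_all d => A; apply: disjointWl.
by rewrite !sub ?subsetUl ?subsetUr // chain_block_disjoint.
Qed.

Lemma chain_sumn X Js : chain X Js -> (#|X| + sumn (etype Js) = k)%N.
Proof.
elim=> [|{}X j {}Js sXI njI nj _ IH] /=; first by rewrite addn0.
by rewrite addnA -card_extend.
Qed.

Lemma chain_pos X Js : chain X Js -> all (fun l => (0 < l)%N) (etype Js).
Proof.
elim=> [|{}X j {}Js sXI njI nj _ IH] //=; rewrite IH andbT card_block //=.
by rewrite card_gt0 setD_eq0.
Qed.

Lemma size_chain X Js : chain X Js -> (size Js <= k)%N.
Proof.
move=> c; have := chain_pos c; rewrite -(chain_sumn c).
suff : all (fun l => (0 < l)%N) (etype Js) -> (size Js <= sumn (etype Js))%N.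
  by move=> h /h /leq_trans; apply; rewrite leq_addl.
elim: Js {c} => //= A Js IH /andP[A0 /IH]; lia.
Qed.

(** Keeping the part of each block inside [I] gives a reordering of [I]. *)
Lemma chain_distinguished Js s : chain set0 Js -> indep b s -> [set i in s] = I ->
  distinguished b Js (flag b s).
Proof.
move=> c is_ sI; apply/existsP; exists [tuple of [seq A :&: I | A <- in_tuple Js]].
apply/andP; split.
  rewrite /=; elim: c => [|X j Js' sXI njI nj _ IH] //=.
  by rewrite IH andbT subsetIl block_setI // card_block //=.
rewrite /= -map_comp (eq_map (g := fun A : {set 'I_n} => flag b (enum (A :&: I)))) //.
rewrite wedges_flag -/(kept I Js).
have ps : perm_eq s (kept I Js).
  rewrite (permPr (kept_perm c)) setD0 -sI perm_sym perm_enum_set //; exact: indep_uniq is_.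
rewrite (perm_flag b ps) -signr_odd; case: (odd _); rewrite ?expr1 ?expr0 ?scaleN1r ?scale1r.
  by rewrite eqxx orbT.
by rewrite eqxx.
Qed.

(** Disjointness forces the element [j] dropped from the first block to lie
    outside [I].  Condition (i) puts row [j] in the span of [X] and the kept
    part [L], and condition (ii) excludes that it lies in the span without some
    element of [L]; hence [L] is the new part of the support of [j]. *)
Lemma elementary_chain X Y Js Ks : X \subset I -> gspan b Y = gspan b X -> X \subset Y ->
  all2 (fun K J : {set 'I_n} => (K \subset J) && (#|K| == #|J|.-1)) Ks Js ->
  pairwise (fun A B : {set 'I_n} => [disjoint A & B]) Js ->
  all (fun A : {set 'I_n} => [disjoint Y & A]) Js ->
  flatten [seq enum K | K : {set 'I_n} <- Ks] =i I :\: X ->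
  uniq (flatten [seq enum K | K : {set 'I_n} <- Ks]) ->
  all (fun l => (0 < l)%N) (etype Js) ->
  elementary_from Y #|X| Js -> chain X Js.
Proof.
elim: Js Ks X Y => [|A Js IH] [|L Ks] X Y //= sXI eY sXY.
  move=> _ _ _ eI _ _ _; suff -> : X = I by apply: Chain_nil.
  apply/eqP; rewrite eqEsubset sXI -setD_eq0; apply/eqP/setP => i.
  by rewrite -eI inE.
case/andP=> /andP[sLA /eqP cL] a2 /andP[dA pd] /andP[dYA dY] eI uLK /andP[A0 Jpos].
case/andP=> /and3P[_ /eqP dimA /forall_inP dimAi] eF.
have LI : L \subset I :\: X.
  by apply/subsetP => p pL; rewrite -eI mem_cat mem_enum pL.
have /cards1P[j jE] : #|A :\: L| == 1%N.
  by rewrite cardsD (setIidPr sLA) cL; move: A0; case: #|A| => // m _; rewrite subSnn.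
have jA : j \in A by have := set11 j; rewrite -jE inE => /andP[].
have njL : j \notin L by have := set11 j; rewrite -jE inE => /andP[].
have AE : A = j |: L.
  by rewrite -jE setUC setDE setUIr setUCr setIT; apply/esym/setUidPr.
have njI : j \notin I.
  apply/negP => jI; case: (boolP (j \in X)) => [jX|njX].
    by have := disjointFr dYA (subsetP sXY _ jX); rewrite jA.
  have : j \in enum L ++ flatten [seq enum K | K : {set 'I_n} <- Ks].
    by rewrite eI inE njX.
  rewrite mem_cat mem_enum (negbTE njL) /= => /flattenP[_ /mapP[L' L'K ->]].
  rewrite mem_enum => jL'.
  have [B BJ sL'B] : exists2 B, B \in Js & L' \subset B.
    elim: Ks Js a2 L'K {IH eI uLK dA pd dY Jpos eF} => [|L1 Ks IHK] [|B1 Js] //=.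
    case/andP=> /andP[s1 _] a2; rewrite inE => /orP[/eqP->|/(IHK _ a2)[B BJ sB]].
      by exists B1; rewrite ?mem_head.
    by exists B; rewrite // inE BJ orbT.
  by have := disjointFr (allP dA _ BJ) jA; rewrite (subsetP sL'B).
have sXL : X :|: L \subset I.
  by rewrite subUset sXI (subset_trans LI) // subsetDl.
have dXL : #|X :|: L| = (#|X| + #|L|)%N.
  rewrite cardsU (_ : X :&: L = set0) ?cards0 ?subn0 //; apply/setP => p; rewrite !inE.
  by case: (boolP (p \in L)) => [/(subsetP LI)|]; rewrite ?andbF // inE => /andP[/negbTE->].
have dim_XL (Z : {set _}) : Z \subset I -> \dim (gspan b Z) = #|Z|.
  by move=> sZ; rewrite -sspan_enum dim_sspan ?(indep_sub iI) // -cardE.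
have sub1 : (gspan b (X :|: L) <= gspan b (Y :|: A))%VS.
  by apply: gspanS; rewrite setUSS.
have e1 : gspan b (Y :|: A) = gspan b (X :|: L).
  by apply/esym/eqP; rewrite eqEdim sub1 dimA dim_XL // dXL cL leqnn.
have sj : supp j \subset X :|: L.
  by rewrite -(mem_gspan_bsupp iI cI) // -e1 mem_gspan // inE jA orbT.
have LE : L = supp j :\: X.
  apply/eqP; rewrite eqEsubset subDset sj andbT; apply/subsetP => p pL.
  have /andP[npX pI] : (p \notin X) && (p \in I) by have := subsetP LI _ pL; rewrite inE.
  rewrite in_setD npX /=; apply/negPn/negP => npj.
  have pA : p \in A := subsetP sLA _ pL.
  have : (gspan b ((Y :|: A) :\ p) <= gspan b ((X :|: L) :\ p))%VS.
    rewrite setDUl gspanU subv_add; apply/andP; split.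
      apply: subv_trans (gspanS b (subsetDl _ _)) _; rewrite eY; apply: gspanS.
      by apply/subsetP => q qX; rewrite !inE qX andbT; apply: contraNneq npX => <-.
    apply/gspan_subP => q; rewrite AE !inE => /andP[qp /orP[/eqP->|qL]].
      rewrite (mem_gspan_bsupp iI cI); last by apply: subset_trans sXL; apply: subsetDl.
      by rewrite subsetD1 sj.
    by apply: mem_gspan; rewrite !inE qp qL orbT.
  move=> /dimvS; rewrite (eqP (dimAi _ pA)) dim_XL; last first.
    by apply: subset_trans sXL; apply: subsetDl.
  by rewrite -cL -dXL (cardsD1 p) in_setU pL orbT add1n ltnn.
have nj : ~~ (supp j \subset X).
  by rewrite -setD_eq0 -LE -card_gt0 cL.
have AB : A = block X j by rewrite /step_block -LE.
rewrite {1}AB; apply: Chain_cons => //.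
have XjE : X :|: supp j = X :|: L by rewrite LE setU_block.
apply: (IH Ks _ (Y :|: A)) => //.
- by rewrite XjE.
- by rewrite XjE e1.
- by rewrite XjE setUSS.
- apply/allP => B BJ; have := allP dY _ BJ; have := allP dA _ BJ.
  by rewrite -!setI_eq0 setIUl => /eqP-> /eqP->; rewrite setU0.
- move=> p; have := eI p; rewrite mem_cat mem_enum XjE !inE.
  move: uLK; rewrite cat_uniq => /and3P[_ /hasPn nh _].
  case: (boolP (p \in L)) => pL /=; rewrite ?orbF ?orbT /= => // _.
  by apply/negP => /nh; rewrite mem_enum pL.
- by move: uLK; rewrite cat_uniq => /and3P[].
- by rewrite XjE dXL cL.
Qed.

Lemma elementary_throughP Js s : indep b s -> [set i in s] = I ->
  elementary b (etype Js) Js && distinguished b Js (flag b s) <-> chain set0 Js.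
Proof.
move=> is_ sI; split; last first.
  move=> c; rewrite (chain_distinguished c) // andbT elementaryE (chain_pos c).
  have := chain_sumn c; rewrite cards0 add0n => ->; rewrite eqxx /=.
  have s0 : set0 :&: I \subset (set0 : {set 'I_n}) by rewrite set0I.
  have /andP[-> _] := chain_disjoint c (erefl _) s0.
  by rewrite -[X in elementary_from _ X](cards0 'I_n) (chain_elementary_from c).
rewrite elementaryE => /andP[/and4P[Jpos _ pd eF] /existsP[Ks /andP[a2]]] /=.
rewrite wedges_flag => fE.
set kap := flatten _ in fE.
have f0 : flag b s I != 0 by rewrite flag_at // -sI eqxx mulr1 signr_eq0.
have ik : indep b kap.
  by apply: contraNT f0 => nk; move: fE; rewrite (flag_dep nk) oppr0 orbb => /eqP->; rewrite ffunE.
have kI : [set i in kap] = I.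
  apply/eqP; apply: contraNT f0 => nI.
  have fk : flag b kap I = 0 by rewrite flag_at // eq_sym (negbTE nI) mulr0.
  by case/orP: fE => /eqP ->; rewrite ?ffunE fk ?oppr0.
apply: (@elementary_chain set0 set0 Js Ks) => //.
- exact: sub0set.
- by apply/allP => A _; rewrite -setI_eq0 set0I.
- by move=> i; rewrite setD0 -kI inE.
- exact: indep_uniq ik.
- by rewrite cards0.
Qed.

End Elementary.

(** * Weights and sign normalization *)

Section Normalization.
Variables (K : fieldType) (n k : nat) (b : 'M[K]_(n, k)) (a : 'I_n -> K) (I : {set 'I_n}).
Hypotheses (iI : indep b (enum I)) (cI : #|I| = k).
Implicit Types (X Y A B C : {set 'I_n}) (Js : seq {set 'I_n}) (u v : flags K n).
Local Notation supp := (bsupp b I).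
Local Notation chain := (block_chain b I).
Local Notation block := (step_block b I).

Lemma tail_weightE X : X \subset I ->
  tail_weight b a I X = \sum_(i < n | row i b \notin gspan b X) a i.
Proof. by move=> sXI; apply: eq_bigl => i; rewrite (mem_gspan_bsupp iI cI). Qed.

(** The subspace X_h^* is spanned by the set reached after [h] steps. *)
Lemma chain_weightE X Y Js : chain X Js -> gspan b Y = gspan b X ->
  chain_weight b a I X Js =
  \prod_(0 <= h < size Js) \sum_(i < n | row i b \notin gspan b (Y :|: Jcup Js h)) a i.
Proof.
move=> c; elim: c Y => [|{}X j {}Js sXI njI nj _ IH] Y eY; first by rewrite big_nil.
rewrite [size _]/= big_nat_recl // Jcup0 setU0 eY -tail_weightE //=.
rewrite block_setI // setU_block (IH _ (gspan_block iI cI j sXI eY)); congr (_ * _).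
by apply: eq_bigr => h _; rewrite Jcup_cons -setUA.
Qed.

Lemma eweight_chain Js : (0 < k)%N -> (forall j, row j b != 0) -> chain set0 Js ->
  eweight b a Js = chain_weight b a I set0 Js.
Proof.
move=> k0 b0 c; rewrite (chain_weightE c (erefl _)) /eweight.
have J0 : (0 < size Js)%N.
  have := chain_sumn cI c; rewrite cards0 add0n => sJ; rewrite lt0n.
  by apply: contraTneq k0 => /size0nil J; rewrite -sJ J.
rewrite (big_ltn J0) Jcup0 setU0; congr (_ * _).
  apply: eq_bigl => i; rewrite -sspan_enum enum_set0 /sspan span_nil memv0.
  by rewrite b0.
by apply: eq_bigr => h _; rewrite set0U.
Qed.

(** Coordinates at sets not contained in [I] never contribute to coordinates
    at subsets of [I]. *)
Lemma wedge_restrict u u' v v' :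
    (forall A, A \subset I -> u A = u' A) -> (forall A, A \subset I -> v A = v' A) ->
  forall C, C \subset I -> wedge b u v C = wedge b u' v' C.
Proof.
move=> eu ev C sC; rewrite /wedge !sum_ffunE; apply: eq_bigr => A _.
rewrite !sum_ffunE; apply: eq_bigr => B _; rewrite !ffunE.
case: (boolP (indep b (enum A ++ enum B))) => iAB; last first.
  by rewrite flag_dep // ffunE ![_ *: _]mulr0.
rewrite !(flag_at C iAB); case: eqP => [CE|_]; last by rewrite mulr0 ![_ *: _]mulr0.
have [sA sB] : A \subset I /\ B \subset I.
  split; apply: subset_trans sC; apply/subsetP => i iA; rewrite CE inE mem_cat !mem_enum iA //.
  by rewrite orbT.
by rewrite eu // ev.
Qed.

Lemma flag_cons_restrict j w A : j \notin I -> A \subset I -> wedge b (flag b [:: j]) w A = 0.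
Proof.
move=> njI sA; rewrite wedge_expandr sum_ffunE big1 // => B _.
rewrite ffunE wedge_flag_unit /=.
case: (boolP (indep b (j :: enum B))) => ij; last by rewrite flag_dep // ffunE [_ *: _]mulr0.
rewrite (flag_at A ij); case: eqP => [AE|_]; last by rewrite mulr0 [_ *: _]mulr0.
by case/negP: njI; apply: (subsetP sA); rewrite AE inE mem_head.
Qed.

(** Every exchanged term of a factor contains an index outside [I], so only
    the leading terms are visible at subsets of [I]. *)
Lemma singular_of_restrict X Js : chain X Js ->
  forall C, C \subset I -> singular_of b a I Js C =
     ((\prod_(A <- Js) \prod_(j in A :\: I) a j) *: flag b (kept I Js)) C.
Proof.
elim=> [|{}X j {}Js sXI njI nj _ IH].
  by move=> C _; rewrite big_nil scale1r.
have e A : A \subset I -> singular_factor b a (block_seq I (block X j)) A =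
     (a j *: flag b (enum (block X j :&: I))) A.
  rewrite block_seq_block // block_setI // => sA.
  have nj' : j \notin enum (supp j :\: X).
    by rewrite mem_enum in_setD (contraNF (subsetP (bsupp_sub b I j) j) njI) andbF.
  rewrite singular_factor_cons //; set w := wedge _ _ _.
  have w0 : w A = 0 by apply: flag_cons_restrict.
  by rewrite ffunE [(- w) A]ffunE w0 subr0.
move=> A sA; rewrite /singular_of /singular_element /=.
rewrite -/(singular_element _ _ _) -/(singular_of _ _ _ _).
rewrite (wedge_restrict e IH sA) linearZl_LR linearZr_LR /= wedge_flag scalerA big_cons.
by rewrite block_setD // big_set1.
Qed.

(** Reordering the entries of each block changes a singular element by a sign only. *)
Lemma singular_element_enum Js : exists m,
  singular_element b a [seq enum A | A : {set 'I_n} <- Js] = (-1) ^+ m *: singular_of b a I Js.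
Proof.
rewrite /singular_of; elim: Js => [|A Js [m IH]] /=; first by exists 0%N; rewrite scale1r.
have pA : perm_eq (enum A) (block_seq I A).
  apply: uniq_perm; rewrite ?enum_uniq ?uniq_block_seq // => i.
  by rewrite mem_cat !mem_enum !inE; case: (i \in I); rewrite /= ?andbT ?andbF ?orbF.
have sA := perm_singular_factor b a (enum_uniq A) pA.
rewrite /singular_element /= -!/(singular_element _ _ _) IH sA.
by eexists; rewrite linearZl_LR linearZr_LR /= scalerA -exprD.
Qed.

(** The coefficient that the normalizing test looks at is [pi] or [- pi]; the test
    detects the sign because [pi] is nonzero and the characteristic is not 2. *)
Lemma singular_element_atE s Js : 2 != 0 :> K -> (forall j, a j != 0) ->
    indep b s -> [set i in s] = I -> chain set0 Js ->
  singular_element_at b a s Js =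
  (-1) ^+ (inversions s + inversions (kept I Js)) *: singular_of b a I Js.
Proof.
move=> two0 a0 is_ sI c; rewrite /singular_element_at; have [m ->] := singular_element_enum Js.
set pi := \prod_(A <- Js) \prod_(j in A :\: I) a j.
have pi0 : pi != 0.
  by rewrite prodf_seq_neq0; apply/allP => A _; apply/prodf_neq0 => j _; apply: a0.
have ps : perm_eq (kept I Js) (enum I) by rewrite (permPl (kept_perm c)) setD0.
have kI : flag b (kept I Js) I = (-1) ^+ inversions (kept I Js).
  rewrite flag_at ?(perm_indep b ps) //; case: eqP => [_|[]]; first by rewrite mulr1.
  by rewrite (eq_set_perm ps) set_enum.
have cE : flag_coef s ((-1) ^+ m *: singular_of b a I Js) =
     (-1) ^+ (inversions s + m + inversions (kept I Js)) * pi.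
  rewrite /flag_coef sI ffunE (singular_of_restrict c) // ffunE kI -/pi.
  by rewrite !exprD -[_ *: _]/(_ * (_ * _)); ring.
rewrite sI cE -/pi; set q := (_ + _ + _)%N.
have -> : (-1) ^+ (inversions s + inversions (kept I Js)) = (-1) ^+ (q + m) :> K.
  by apply: eq_signr; rewrite !oddD; do 3!case: (odd _).
rewrite exprD -signr_odd; case: (odd q); rewrite ?expr0 ?expr1 ?mul1r ?eqxx //.
case: eqP => [e|_]; last by rewrite mulN1r scaleNr.
case/eqP: two0; apply: (mulIf pi0); rewrite mul0r -[2]/(1 + 1) mulrDl mul1r -{1}e.
by rewrite mulN1r addNr.
Qed.

End Normalization.

(** * The weights do not vanish *)

Section Unbalanced.
Variables (K : fieldType) (n k : nat) (b : 'M[K]_(n, k)) (a x : 'I_n -> K) (I : {set 'I_n}).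
Hypotheses (iI : indep b (enum I)) (cI : #|I| = k).
Hypotheses (nc : normal_crossings b x) (ub : unbalanced b x a).
Implicit Types (X Y A B C : {set 'I_n}).
Local Notation supp := (bsupp b I).

Lemma row_mulmx m (A : 'M[K]_(m, k)) (t : 'cV[K]_k) i : (row i A *m t) 0 0 = (A *m t) i 0.
Proof. by rewrite !mxE; apply: eq_bigr => j _; rewrite mxE. Qed.

Lemma bsupp_mul j (t : 'cV[K]_k) c : row j b = \sum_(p in supp j) c p *: row p b ->
  (b *m t) j 0 = \sum_(p in supp j) c p * (b *m t) p 0.
Proof.
move=> cE; rewrite -row_mulmx cE mulmx_suml summxE; apply: eq_bigr => p _.
by rewrite -scalemxAl mxE row_mulmx.
Qed.

Lemma dual_point (y : 'I_n -> K) : exists t : 'cV[K]_k, {in I, forall p, (b *m t) p 0 = y p}.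
Proof.
pose M := \matrix_(h < #|I|) row (enum_val h) b.
have fM : row_free M.
  apply: inj_row_free => v; rewrite mulmx_sum_row => v0; apply/rowP => h; rewrite mxE.
  have hI := enum_valP h.
  have := sum_indep0 (c := fun p => v 0 (enum_rank_in hI p)) iI _ hI.
  rewrite enum_valK_in; apply; rewrite big_enum_val -[RHS]v0; apply: eq_bigr => i _.
  by rewrite enum_valK_in rowK.
exists (pinvmx M *m \col_h y (enum_val h)) => p pI.
rewrite -(enum_rankK_in pI pI); set h := enum_rank_in pI p.
have -> : (b *m (pinvmx M *m \col_h y (enum_val h))) (enum_val h) 0 =
    (M *m (pinvmx M *m \col_h y (enum_val h))) h 0.
  by rewrite -[LHS]row_mulmx -[RHS]row_mulmx rowK.
by rewrite mulmxA mulmxVp // mul1mx mxE.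
Qed.

Lemma dual_unique (t : 'cV[K]_k) : {in I, forall p, (b *m t) p 0 = 0} -> t = 0.
Proof.
move=> t0; apply/colP => i; rewrite [RHS]mxE.
have /gspan_sum[c cE] : delta_mx 0 i \in gspan b I by rewrite (gspan_basis iI cI) memvf.
have -> : t i 0 = ((delta_mx 0 i : 'rV[K]_k) *m t) 0 0 by rewrite -rowE mxE.
rewrite cE mulmx_suml summxE big1 // => p pI.
by rewrite -scalemxAl mxE row_mulmx t0 // mulr0.
Qed.

(** If equality held, [j] would pass through the vertex cut out by [I]. *)
Lemma circuit_generic j c : j \notin I -> row j b = \sum_(p in supp j) c p *: row p b ->
  x j != \sum_(p in supp j) c p * x p.
Proof.
move=> njI cE; apply/negP => /eqP xE.
have [t tE] := dual_point (fun p => - x p).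
have vt : vertex b x t.
  exists I => t'; split=> [ht|-> p pI]; last by rewrite /on_hyperplane tE // addNr.
  apply/eqP; rewrite -subr_eq0; apply/eqP/dual_unique => p pI.
  rewrite mulmxBr [LHS]mxE [X in _ + X]mxE tE // opprK; exact/eqP/ht.
have := nc vt; set Z := [set _ | _] => cZ.
have sIZ : I \subset Z by apply/subsetP => p pI; rewrite inE /on_hyperplane tE // addNr.
have /eqP ZI : I == Z by rewrite eqEcard sIZ cZ cI leqnn.
case/negP: njI; rewrite ZI inE /on_hyperplane (bsupp_mul _ cE) xE -big_split /=.
rewrite big1 // => p pj; rewrite tE ?mulrN ?addNr //.
by apply: subsetP pj; apply: bsupp_sub.
Qed.

(** The hyperplanes containing the edge at infinity where the linear forms in the span of
    [X] vanish. *)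
Definition flat X : {set option 'I_n} := None |: [set Some j | j in [set j | supp j \subset X]].

Lemma Some_flat X j : (Some j \in flat X) = (supp j \subset X).
Proof. by rewrite !inE /= mem_imset ?inE //; apply: Some_inj. Qed.

Lemma None_flat X : None \in flat X.
Proof. exact: setU11. Qed.

Lemma mem_hhyperplane o (t : 'cV[K]_(1 + k)) :
  (t \in hhyperplane b x o) = (hform b x o *m t == 0).
Proof. by rewrite memv_ker lfunE. Qed.

Lemma mem_hhyperplane_inf j (t : 'cV[K]_k) :
  (col_mx 0 t \in hhyperplane b x (Some j)) = ((b *m t) j 0 == 0).
Proof.
rewrite mem_hhyperplane mul_row_col mulmx0 add0r -row_mulmx; apply/eqP/eqP => [->|e].
  by rewrite mxE.
by apply/matrixP => i h; rewrite !ord1 e mxE.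
Qed.

(** The points at infinity dual to the basis elements outside [X] lie on the edge, and
    they separate it from each hyperplane not in [flat X]. *)
Lemma cone_flat X p : X \subset I -> p \in I -> p \notin X -> exists t : 'cV[K]_k,
  [/\ (b *m t) p 0 = 1, col_mx 0 t \in cone b x (flat X) &
   forall j, p \in supp j -> col_mx 0 t \notin hhyperplane b x (Some j)].
Proof.
move=> sXI pI npX; have [t tE] := dual_point (fun q => (q == p)%:R).
have tI j q : q \in supp j -> (b *m t) q 0 = (q == p)%:R.
  by move=> qj; apply: tE; apply: subsetP qj; apply: bsupp_sub.
exists t; split; first by rewrite tE ?eqxx.
  rewrite memvE; apply/subv_bigcapP => -[j|]; last first.
    by rewrite -memvE mem_hhyperplane mul_row_col mulmx0 mul0mx addr0.
  rewrite Some_flat -memvE mem_hhyperplane_inf => sj.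
  have [c cE _] := bsupp_sum iI cI j; rewrite (bsupp_mul _ cE) big1 // => q qj.
  rewrite (tI j) // (_ : q == p = false) ?mulr0 //; apply: contraNF npX => /eqP <-.
  exact: subsetP qj.
move=> j pj; have [c cE c0] := bsupp_sum iI cI j.
rewrite mem_hhyperplane_inf (bsupp_mul _ cE) (bigD1 p) //= (tI j) // eqxx mulr1.
rewrite big1 ?addr0 ?c0 // => q /andP[qj /negbTE qp]; by rewrite (tI j) // qp mulr0.
Qed.

Lemma containing_flat X : X \subset I -> containing b x (cone b x (flat X)) = flat X.
Proof.
move=> sXI; apply/setP => o; rewrite inE; apply/idP/idP => [sc|oX]; last exact: bigcapv_inf oX _.
case: o sc => [j|_]; last exact: None_flat.
rewrite Some_flat; apply: contraTT => /subsetPn[p pj npX].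
have pI : p \in I by apply: subsetP pj; apply: bsupp_sub.
have [t [_ tc /(_ _ pj)]] := cone_flat sXI pI npX.
by apply: contra => /subvP; apply.
Qed.

Lemma hformE j : hform b x (Some j) = x j *: hform b x None + row_mx 0 (row j b).
Proof.
rewrite /= scale_row_mx scaler0 add_row_mx add0r addr0; congr (row_mx _ _).
by rewrite scalemx1.
Qed.

(* a relation splits along the blocks *)
(** Forms in different blocks have no common coordinate after the change [M], so
    the partial sums over a block and over its complement have disjoint
    supports, and both vanish when the total does. *)
Lemma reducible_split (B : {set option 'I_n}) (P : {set {set option 'I_n}})
    (M : 'M[K]_(1 + k)) (B0 : {set option 'I_n}) (e : option 'I_n -> K) :
  partition P B -> M \in unitmx -> B0 \in P ->
  (forall B1 B2 : {set option 'I_n}, B1 \in P -> B2 \in P -> B1 != B2 ->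
      forall o1 o2, o1 \in B1 -> o2 \in B2 ->
      forall c, (hform b x o1 *m M) 0 c = 0 \/ (hform b x o2 *m M) 0 c = 0) ->
  \sum_(o in B) e o *: hform b x o = 0 -> \sum_(o in B :\: B0) e o *: hform b x o = 0.
Proof.
case/and3P=> /eqP cP tP _ uM B0P sep; rewrite (big_setID B0) /=.
set u := \sum_(o in B :&: B0) _; set w := \sum_(o in B :\: B0) _ => uw.
suff : w *m M = 0 by move/(congr1 (mulmx^~ (invmx M))); rewrite mulmxK // mul0mx.
apply/rowP => h; rewrite [RHS]mxE.
have wE : (w *m M) 0 h = \sum_(o in B :\: B0) e o * (hform b x o *m M) 0 h.
  by rewrite mulmx_suml summxE; apply: eq_bigr => o _; rewrite -scalemxAl mxE.
have uE : (w *m M) 0 h = - \sum_(o in B :&: B0) e o * (hform b x o *m M) 0 h.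
  have -> : w = - u by apply/eqP; rewrite -addr_eq0 addrC uw.
  rewrite mulNmx mxE mulmx_suml summxE; congr (- _).
  by apply: eq_bigr => o _; rewrite -scalemxAl mxE.
case: (boolP [forall o in B :\: B0, (hform b x o *m M) 0 h == 0]) => [/forall_inP z|].
  by rewrite wE big1 // => o /z /eqP ->; rewrite mulr0.
rewrite negb_forall_in => /exists_inP[o]; rewrite inE => /andP[oB0 oB] oh.
rewrite uE big1 ?oppr0 // => o1; rewrite inE => /andP[_ o1B0].
have oc : o \in cover P by rewrite cP.
have oP := pblock_mem oc.
have nB : B0 != pblock P o by apply: contraNneq oB0 => ->; rewrite mem_pblock.
have oPo : o \in pblock P o by rewrite mem_pblock.
have [-> | z] := sep _ _ B0P oP nB _ _ o1B0 oPo h; first by rewrite mulr0.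
by rewrite z eqxx in oh.
Qed.

(** The relation expressing row [j] in the basis lifts to homogeneous
    coordinates with a nonzero multiple [gamma] of the form at infinity, by
    [circuit_generic].  Splitting it along the blocks leaves only relations
    impossible for a circuit, unless the whole circuit lies in the block of
    infinity. *)
Lemma circuit_in_block X (P : {set {set option 'I_n}}) (M : 'M[K]_(1 + k))
    (B0 : {set option 'I_n}) j :
    partition P (flat X) -> M \in unitmx -> B0 \in P -> None \in B0 ->
    (forall B1 B2 : {set option 'I_n}, B1 \in P -> B2 \in P -> B1 != B2 ->
      forall o1 o2, o1 \in B1 -> o2 \in B2 ->
      forall c, (hform b x o1 *m M) 0 c = 0 \/ (hform b x o2 *m M) 0 c = 0) ->
    j \notin I -> supp j \subset X -> X \subset I ->
  Some j \in B0 /\ forall p, p \in supp j -> Some p \in B0.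
Proof.
move=> pP uM B0P N0 sep njI sj sXI.
have [c cE c0] := bsupp_sum iI cI j.
pose gamma := x j - \sum_(p in supp j) c p * x p.
pose d i : K := (i == j)%:R - c i *+ (i \in supp j).
(* [e] lists the coefficients of the lifted relation, [None] being infinity. *)
pose e o : K := if o is Some i then d i else - gamma.
have dsum (V : lmodType K) (F : 'I_n -> V) (T : {set 'I_n}) :
    \sum_(i in T) d i *: F i = (if j \in T then F j else 0) - \sum_(p in supp j :&: T) c p *: F p.
  under eq_bigr do rewrite scalerBl.
  rewrite sumrB; congr (_ - _).
    case: ifP => jT; last first.
      rewrite big1 // => i iT; rewrite (_ : i == j = false) ?scale0r //.
      by apply: contraFF jT => /eqP <-.
    rewrite (bigD1 j) //= eqxx scale1r big1 ?addr0 // => i /andP[_ /negbTE->].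
    by rewrite scale0r.
  rewrite (bigID (mem (supp j))) /= [X in _ + X]big1 ?addr0 => [|i /andP[_ /negbTE->]]; last first.
    by rewrite mulr0n scale0r.
  rewrite [RHS](eq_bigl (fun i => (i \in T) && (i \in supp j))) => [|i]; last first.
    by rewrite in_setI andbC.
  by apply: eq_bigr => i /andP[_ ->].
have sumE (T : {set option 'I_n}) : None \notin T ->
    \sum_(o in T) e o *: hform b x o = \sum_(i in [set i | Some i \in T]) d i *: hform b x (Some i).
  move=> nT; have -> : T = [set Some i | i in [set i | Some i \in T]].
    apply/setP => -[i|]; first by rewrite mem_imset ?inE //; apply: Some_inj.
    by rewrite (negbTE nT); apply/esym/imsetP => -[].
  rewrite big_imset /=; last by move=> i i' _ _ [].
  by apply: eq_bigl => i; rewrite !inE mem_imset ?inE //; apply: Some_inj.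
have rel : \sum_(o in flat X) e o *: hform b x o = 0.
  rewrite (big_setD1 None) ?None_flat //= sumE ?setD11 //.
  set T := [set i | _ ].
  have TE i : i \in T = (supp i \subset X) by rewrite inE in_setD1 Some_flat.
  have -> : \sum_(i in T) d i *: hform b x (Some i) =
      (\sum_(i in T) d i *: (x i : K^o)) *: hform b x None +
      row_mx 0 (\sum_(i in T) d i *: row i b).
    rewrite scaler_suml -[row_mx 0 _](_ : \sum_(i in T) d i *: row_mx 0 (row i b) = _).
      rewrite -big_split; apply: eq_bigr => i _; rewrite hformE scalerDr scalerA //.
    rewrite (eq_bigr (fun i => row_mx 0 (d i *: row i b))) => [|i _].
      by elim/big_rec2: _ => [|i u v _ ->]; rewrite ?row_mx0 // add_row_mx addr0.
    by rewrite scale_row_mx scaler0.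
  have sT : supp j :&: T = supp j.
    apply/setIidPl/subsetP => p pj; rewrite TE bsupp_basis //; last first.
      by apply: subsetP pj; apply: bsupp_sub.
    by rewrite sub1set (subsetP sj).
  rewrite !dsum TE sj sT -cE subrr row_mx0 addr0 -scalerDl.
  rewrite [X in X *: _](_ : _ = 0) ?scale0r //; exact: addNr.
have := reducible_split pP uM B0P sep rel.
rewrite sumE; last by rewrite in_setD N0.
set T := [set i | _] => TE.
have TP i : Some i \in flat X -> (i \in T) = (Some i \notin B0).
  by move=> iX; rewrite inE in_setD iX andbT.
have relr : \sum_(i in T) d i *: row i b = 0.
  transitivity (rsubmx (\sum_(i in T) d i *: hform b x (Some i))); last by rewrite TE linear0.
  by rewrite linear_sum; apply: eq_bigr => i _; rewrite linearZ /= row_mxKr.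
have rell : \sum_(i in T) d i *: (x i : K^o) = 0.
  transitivity (lsubmx (\sum_(i in T) d i *: hform b x (Some i)) 0 0); last first.
    by rewrite TE linear0 mxE.
  rewrite linear_sum summxE; apply: eq_bigr => i _.
  by rewrite linearZ /= row_mxKl !mxE eqxx mulr1n.
have jX : Some j \in flat X by rewrite Some_flat.
have pX p : p \in supp j -> Some p \in flat X.
  move=> pj; rewrite Some_flat bsupp_basis ?sub1set ?(subsetP sj) //.
  by apply: subsetP pj; apply: bsupp_sub.
move: relr rell; rewrite !dsum; case: ifP => jT; last first.
  rewrite sub0r => /eqP; rewrite oppr_eq0 => /eqP s0 _.
  have sTI : supp j :&: T \subset I.
    by apply: subset_trans (subsetIl _ _) (bsupp_sub _ _ _).
  split=> [|p pj]; first by move: jT; rewrite TP // => /negbFE.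
  apply/negPn/negP => npB; have pT : p \in supp j :&: T by rewrite in_setI pj TP ?pX.
  by case/negP: (c0 _ pj); apply/eqP; apply: (sum_indep0 (indep_sub iI sTI) s0 pT).
move=> /eqP; rewrite subr_eq0 => /eqP jE.
have sjT : supp j \subset supp j :&: T.
  rewrite -(mem_gspan_bsupp iI cI); last by apply: subset_trans (subsetIl _ _) (bsupp_sub _ _ _).
  by rewrite jE sum_gspan.
have -> : supp j :&: T = supp j by apply/eqP; rewrite eqEsubset sjT subsetIl.
move=> /eqP; rewrite subr_eq0 => /eqP xE.
by case/negP: (circuit_generic njI cE); rewrite xE.
Qed.

(** Elements of [X] lie in circuits through infinity because [X] is closed. *)
Lemma flat_irreducible X : chain_closed b I X -> ~ reducible b x (flat X).
Proof.
case=> sXI cX [P [pP cP [M uM sep]]].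
have /and3P[/eqP covP tP nP] := pP.
have Nc : None \in cover P by rewrite covP None_flat.
set B0 := pblock P None.
have B0P : B0 \in P := pblock_mem Nc.
have N0 : None \in B0 by rewrite mem_pblock.
have cb j := circuit_in_block (j := j) pP uM B0P N0 sep.
have XB p : p \in X -> Some p \in B0.
  by move=> /cX[j [njI pj sj]]; have [_] := cb _ njI sj sXI; apply.
have allB o : o \in flat X -> o \in B0.
  case: o => [j|//]; rewrite Some_flat => sj.
  case: (boolP (j \in I)) => jI; last by case: (cb _ jI sj sXI).
  by apply: XB; move: sj; rewrite bsupp_basis // sub1set.
have : (0 < #|P :\ B0|)%N by move: cP; rewrite (cardsD1 B0) B0P.
case/card_gt0P=> B1; rewrite in_setD1 => /andP[nB1 B1P].
have /set0Pn[o oB1] : B1 != set0 by apply: contraNneq nP => <-.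
have oX : o \in flat X by rewrite -covP; apply/bigcupP; exists B1.
by case/eqP: nB1; rewrite -(def_pblock tP B1P oB1) (def_pblock tP B0P (allB _ oX)).
Qed.

Lemma tail_weight_neq0 X : chain_closed b I X -> X != I -> tail_weight b a I X != 0.
Proof.
move=> cX nXI; have sXI := chain_closed_sub cX.
have /subsetPn[p pI npX] : ~~ (I \subset X).
  by apply: contra nXI => sIX; rewrite eqEsubset sXI.
have N0 : flat X != set0 by apply/set0Pn; exists None; apply: None_flat.
have c0 : cone b x (flat X) != 0%VS.
  have [t [t1 tc _]] := cone_flat sXI pI npX.
  apply: contraTneq tc => ->; rewrite memv0; apply/negP => /eqP t0.
  have e : t = 0 by rewrite -[t](col_mxKd (0 : 'M_1)) t0 linear0.
  by move: t1; rewrite e mulmx0 mxE => /eqP; rewrite eq_sym oner_eq0.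
have := ub N0 c0; rewrite containing_flat // => /(_ (flat_irreducible cX)).
suff -> : \sum_(o in flat X) hweight a o = - tail_weight b a I X by rewrite oppr_eq0.
rewrite /flat big_setU1 /=; last by apply/imsetP => -[].
rewrite big_imset /=; last by move=> i j _ _ [].
rewrite [X in _ + X](eq_bigl (fun j => supp j \subset X)) => [|j]; last by rewrite inE.
by rewrite (bigID (fun j => supp j \subset X)) /= opprD addrAC addNr add0r.
Qed.

End Unbalanced.

(** * The orthogonal projection *)

Section Enumeration.
Variables (K : fieldType) (n k : nat) (b : 'M[K]_(n, k)) (a : 'I_n -> K).
Implicit Types (s : seq 'I_n) (X I : {set 'I_n}) (Js : seq {set 'I_n}).

Lemma chain_list_uniq I m X : X \subset I -> uniq (chain_list b I m X).
Proof.
elim: m X => [|m IH] X sXI /=; case: eqP => // _.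
apply: allpairs_uniq_dep; rewrite ?enum_uniq //.
  by move=> j _; apply/IH/setU_supp_sub.
move=> _ _ /allpairsPdep[j [Js [jX _ ->]]] /allpairsPdep[j' [Js' [jX' _ ->]]] /=.
move: jX jX'; rewrite !mem_enum !inE => /andP[njI _] /andP[njI' _] [eb ->].
have := block_setD b X njI; rewrite eb block_setD // => /set1_inj -> //.
Qed.

Lemma indep_entries s : indep b s -> indep b (enum [set i in s]).
Proof. by move=> is_; rewrite indep_enum // (indep_uniq is_). Qed.

Lemma card_entries s : indep b s -> size s = k -> #|[set i in s]| = k.
Proof. by move=> is_ <-; rewrite cardE (perm_size (perm_enum_set (indep_uniq is_))). Qed.

(** Sums over the finite type of bounded sequences become sums over chains. *)
Lemma sum_elementary_through s (V : nmodType) (G : seq {set 'I_n} -> V) :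
  indep b s -> size s = k ->
  \sum_(Js in elementary_through b s) G Js = \sum_(Js <- chain_list b [set i in s] k set0) G Js.
Proof.
move=> is_ sk; set I := [set i in s].
have iI : indep b (enum I) := indep_entries is_.
have cI : #|I| = k := card_entries is_ sk.
rewrite -big_enum /= -(big_map (fun Js : k.-bseq {set 'I_n} => val Js) xpredT G).
apply: perm_big; apply: uniq_perm.
- by rewrite map_inj_uniq ?enum_uniq //; apply: val_inj.
- exact/chain_list_uniq/sub0set.
move=> Js; apply/mapP/idP => [[Bs]|c].
  rewrite mem_enum inE => e ->; apply: chain_in_chain_list; last by rewrite setD0 cI.
  exact/(elementary_throughP iI cI (val Bs) is_ (erefl _)).
have cJ := chain_list_chain (sub0set I) c.
have sJ : (size Js <= k)%N := size_chain iI cI cJ.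
exists (Bseq sJ) => //; rewrite mem_enum inE.
exact/(elementary_throughP iI cI Js is_ (erefl _)).
Qed.

Lemma wedge_nil_singular Ss :
  wedge b (flag b [::]) (singular_element b a Ss) = singular_element b a Ss.
Proof.
move: (singular_element _ _ _) (singular_element_span b a Ss).
apply: span_ind => [|c u v /mapP[t _ ->] IH]; first by rewrite linear0r.
by rewrite linearPr /= wedge_flag IH.
Qed.

End Enumeration.

Section Main.
Variables (K : fieldType) (n k : nat) (b : 'M[K]_(n, k)) (a x : 'I_n -> K).
Hypotheses (two0 : 2 != 0 :> K) (k0 : (0 < k)%N) (b0 : forall j, row j b != 0)
  (a0 : forall j, a j != 0) (nc : normal_crossings b x) (ub : unbalanced b x a).
Implicit Types (s : seq 'I_n) (u v : flags K n).

Definition projection_sum s : flags K n :=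
  \sum_(Js in elementary_through b s) (eweight b a Js)^-1 *: singular_element_at b a s Js.

Lemma projection_sumE s (I := [set i in s]) : indep b s -> size s = k ->
  projection_sum s = (-1) ^+ inversions s *:
    \sum_(Js <- chain_list b I k set0)
      ((-1) ^+ inversions (kept I Js) / chain_weight b a I set0 Js) *: singular_of b a I Js.
Proof.
move=> is_ sk.
have iI : indep b (enum I) := indep_entries is_.
have cI : #|I| = k := card_entries is_ sk.
rewrite /projection_sum.
rewrite (sum_elementary_through (fun Js => (eweight b a Js)^-1 *: singular_element_at b a s Js)) //.
rewrite scaler_sumr big_seq [RHS]big_seq; apply: eq_bigr => Js /(chain_list_chain (sub0set I)) c.
rewrite (singular_element_atE iI two0 a0 is_ (erefl _) c) (eweight_chain a iI cI k0 b0 c).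
by rewrite !scalerA exprD mulrC mulrA.
Qed.

Lemma projection_sum_Sing s : indep b s -> size s = k -> projection_sum s \in Sing b a.
Proof.
move=> is_ sk; rewrite projection_sumE //; apply: memvZ.
rewrite big_seq; apply: memv_suml => Js /(chain_list_chain (sub0set _)) c; apply: memvZ.
exact: (singular_of_Sing a (indep_entries is_) (card_entries is_ sk) c).
Qed.

Lemma projection_sum_orth s v : indep b s -> size s = k -> v \in Sing b a ->
  cform b a (projection_sum s) v = cform b a (flag b s) v.
Proof.
move=> is_ sk vS; set I := [set i in s].
have us := indep_uniq is_.
have iI : indep b (enum I) := indep_entries is_.
have cI : #|I| = k := card_entries is_ sk.
rewrite projection_sumE // linearZl_LR linear_sumlz /=.
rewrite (@perm_flag _ _ _ b s (enum I)); last by rewrite perm_sym perm_enum_set.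
rewrite inversions_enum addn0 linearZl_LR /=; congr (_ * _).
have -> : enum I = [::] ++ enum (I :\: set0) by rewrite setD0.
rewrite (projection_expansion iI cI vS (m := k) _ (chain_closed0 b I)) ?setD0 ?cI //.
- by apply: eq_bigr => Js _; rewrite linearZl_LR /= wedge_nil_singular.
- by move=> X cX XI; exact: (tail_weight_neq0 iI cI nc ub cX XI).
- exact: nil_free.
- by rewrite -sspan_enum enum_set0.
Qed.

Lemma projection_defect s : indep b s -> size s = k ->
  flag b s - projection_sum s \in Sing_perp b a.
Proof.
move=> is_ sk; rewrite memv_cap memvB ?flag_Vflag //=.
  apply/mem_orthovP => v vS; rewrite linearBl /=.
  by rewrite projection_sum_orth // subrr.
by have := projection_sum_Sing is_ sk; rewrite memv_cap => /andP[].
Qed.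

Lemma Vflag_support u A : u \in Vflag b -> A \notin indep_sets b k -> u A = 0.
Proof.
move=> uV nA; elim/span_ind: uV => [|c w v /imageP[B Bk ->] IH]; first by rewrite ffunE.
rewrite !ffunE IH addr0 flag_enum; last by move: Bk; rewrite inE => /andP[].
rewrite ffunE (_ : A == B = false) ?[_ *: _]mulr0 //.
by apply: contraNF nA => /eqP->.
Qed.

Lemma cform_nondegenerate u : u \in Vflag b -> {in Vflag b, forall v, cform b a u v = 0} -> u = 0.
Proof.
move=> uV u0; apply/ffunP => A; rewrite [RHS]ffunE.
case: (boolP (A \in indep_sets b k)) => Ak; last exact: Vflag_support.
have iA : indep b (enum A) by move: Ak; rewrite inE => /andP[].
have := u0 (flag b (enum A)); rewrite flag_Vflag; last first.
  by move: Ak; rewrite inE -cardE => /andP[_ /eqP].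
move=> /(_ isT); rewrite /cform (bigD1 A) //= [X in _ + X]big1 ?addr0 => [|B /andP[_ nBA]]; last first.
  by rewrite flag_enum // ffunE (negbTE nBA) !mulr0.
have pA : \prod_(i in A) a i != 0 by apply/prodf_neq0 => i _; apply: a0.
by rewrite flag_enum // ffunE eqxx mulr1 => /eqP; rewrite mulf_eq0 (negbTE pA) => /eqP.
Qed.

(** Every basis flag is the sum of its projection and its defect. *)
Lemma Sing_add : (Sing b a + Sing_perp b a = Vflag b)%VS.
Proof.
apply/eqP; rewrite eqEsubv subv_add !capvSl /=; apply/span_subvP => _ /imageP[A Ak ->].
move: Ak; rewrite inE => /andP[iA /eqP cA].
have sA : size (enum A) = k by rewrite -cardE.
rewrite -[flag b _](subrK (projection_sum (enum A))) addrC.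
exact: memv_add (projection_sum_Sing iA sA) (projection_defect iA sA).
Qed.

Lemma Sing_cap : (Sing b a :&: Sing_perp b a = 0)%VS.
Proof.
apply/eqP; rewrite -subv0; apply/subvP => u; rewrite memv_cap => /andP[uS uP].
have uV : u \in Vflag b by move: uS; rewrite memv_cap => /andP[].
rewrite memv0; apply/eqP; apply: cform_nondegenerate => // v.
rewrite -Sing_add => /memv_addP[v1 v1S [v2 v2P ->]].
rewrite linearDr /=.
move: uP v2P; rewrite !memv_cap => /andP[_ /mem_orthovP uo] /andP[_ /mem_orthovP vo].
rewrite (uo _ v1S) add0r; have := vo _ uS; by rewrite /= cformC.
Qed.

Lemma Sing_projE s : indep b s -> size s = k ->
  Sing_proj b a (flag b s) = projection_sum s.
Proof.
move=> is_ sk; rewrite -[flag b s](subrK (projection_sum s)) addrC linearD /=.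
rewrite [X in X + _]daddv_pi_id ?Sing_cap ?projection_sum_Sing //.
rewrite -[RHS]addr0; congr (_ + _).
have := daddv_pi_add Sing_cap (w := flag b s - projection_sum s).
rewrite (subvP (addvSr _ _) _ (projection_defect is_ sk)) => /(_ isT).
have Pc : (Sing_perp b a :&: Sing b a = 0)%VS by rewrite capvC Sing_cap.
rewrite [X in _ + X]daddv_pi_id ?projection_defect // => e.
by apply: (addIr (flag b s - projection_sum s)); rewrite add0r.
Qed.

End Main.

Theorem theorem5p1 (R : realType) (n k : nat)
    (b : 'M[R[i]]_(n, k)) (a x : 'I_n -> R[i]) (I : k.-tuple 'I_n) :
  (0 < k < n)%N ->
  (forall j, row j b != 0) ->
  gspan b [set: 'I_n] = fullv ->
  (forall j, a j != 0) ->
  (forall y, normal_crossings b y -> unbalanced b y a) ->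
  normal_crossings b x ->
  indep b I ->
  let s := \sum_(Js in elementary_through b I)
             (eweight b a Js)^-1 *: singular_element_at b a I Js in
  [/\ (Sing b a :&: Sing_perp b a = 0)%VS,
      (Sing b a + Sing_perp b a = Vflag b)%VS,
      Sing_proj b a (flag b I) = s &
      s \in Sing b a].
Proof.
move=> /andP[k0 _] b0 _ a0 ub nc iI s.
have two0 : 2 != 0 :> R[i] by rewrite Num.Theory.pnatr_eq0.
have nu := ub x nc; have sI := size_tuple I.
split.
- exact: (Sing_cap (x := x)).
- exact: (Sing_add (x := x)).
- exact: (Sing_projE (x := x)).
- exact: projection_sum_Sing.
Qed.
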